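(* Let $H$ be a Hopf algebra over a field $k$ and $C$ a right $H$-module coalgebra. Suppose that the map $can:C\otimes H\to C\,\square_{\overline{C}}\,C$, $c\otimes b\mapsto\sum c_1\otimes c_2b$, is injective and that $G(C)H$ contains the coradical of $C$, where $G(C)$ denotes the set of all group-like elements of $C$. Then $C$ is $H$-cocleft.
   Context: All algebras and coalgebras are over a field $k$ and $\otimes=\otimes_k$. A right $H$-module coalgebra is a coalgebra $C$ which is a right $H$-module such that $\Delta:C\to C\otimes C$ and $\varepsilon:C\to k$ are $H$-module maps ($C\otimes C$ with the diagonal $H$-action, $k$ the trivial module). $H^+=\ker\varepsilon_H$, $\overline{C}=C/CH^+$ is the quotient coalgebra of $C$, and $\eta_C:C\to\overline{C}$ is the natural surjection. $C$ is a right and left $\overline{C}$-comodule via $\eta_C$, and $C\,\square_{\overline{C}}\,C$ is the cotensor product, i.e. the kernel of $(\mathrm{id}\otimes\eta_C)\Delta\otimes\mathrm{id}-\mathrm{id}\otimes(\eta_C\otimes\mathrm{id})\Delta:C\otimes C\to C\otimes\overline{C}\otimes C$. $G(C)H=\sum_{g\in G(C)}gH$. $C$ is $H$-cocleft if there is a right $H$-module map $\gamma:C\to H$ which is convolution invertible (invertible in the convolution algebra $\mathrm{Hom}_k(C,H)$). The antipode of $H$ is not assumed bijective. *)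

(* Defs.v *)
From HB Require Import structures.
From mathcomp Require Import all_boot all_algebra ring_quotient sesquilinear.
From mathcomp Require Import boolp classical_sets.
From mathcomp Require Import freeg.

Set Implicit Arguments.
Unset Strict Implicit.
Unset Printing Implicit Defensive.

Import GRing.Theory.
Local Open Scope classical_set_scope.
Local Open Scope ring_scope.

Reserved Notation "U ⊗ V" (at level 40, left associativity).

Section Span.
Variables (k : fieldType) (V : lmodType k).
Implicit Types X S : set V.

Definition is_subspace S : Prop :=
  S 0 /\ forall a u v, S u -> S v -> S (a *: u + v).

Definition lspan X : set V := smallest is_subspace X.

Lemma lspan_subspace X : is_subspace (lspan X).
Proof.
split=> [|a u v Xu Xv] S SX; first by case: SX => -[].
by case: (SX) => -[_ SL] _; apply: SL; [apply: Xu | apply: Xv].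
Qed.

Definition lspan_pred X : {pred V} := fun v => `[< lspan X v >].

Lemma lspan_predP X v : reflect (lspan X v) (v \in lspan_pred X).
Proof. exact: asboolP. Qed.

Lemma lspan_pred_closed X : subsemimod_closed (lspan_pred X).
Proof.
have [X0 XL] := lspan_subspace X; split; first split.
- exact/lspan_predP.
- move=> u v /lspan_predP Xu /lspan_predP Xv; apply/lspan_predP.
  by rewrite -[u]scale1r; apply: XL.
- move=> a u /lspan_predP Xu; apply/lspan_predP.
  by rewrite -[_ *: _]addr0; apply: XL.
Qed.

HB.instance Definition _ X :=
  GRing.isSubmodClosed.Build k V (lspan_pred X) (lspan_pred_closed X).

(** V / span X *)
Definition qmod X : Type := Quotient.quot (lspan_pred X).

End Span.

Section QuotientModule.
Variables (k : fieldType) (V : lmodType k) (X : set V).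

HB.instance Definition _ := GRing.Zmodule.on (qmod X).

Definition qproj (v : V) : qmod X := (\pi_(Quotient.quot (lspan_pred X)) v)%qT.
Definition qrepr (x : qmod X) : V := repr (x : Quotient.quot (lspan_pred X)).

Lemma qreprK : cancel qrepr qproj.
Proof. by move=> x; rewrite /qproj /qrepr reprK. Qed.

Lemma qproj_eq u v : qproj u = qproj v <-> lspan X (u - v).
Proof.
rewrite /qproj; split=> [/eqP|H].
- by rewrite -Quotient.idealrBE => /lspan_predP.
- by apply/eqP; rewrite -Quotient.idealrBE; apply/lspan_predP.
Qed.

Lemma qprojD u v : qproj (u + v) = qproj u + qproj v.
Proof. by rewrite /qproj -raddfD. Qed.

Definition qscale (a : k) (x : qmod X) : qmod X := qproj (a *: qrepr x).

Lemma qprojZ a u : qproj (a *: u) = qscale a (qproj u).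
Proof.
apply/qproj_eq; rewrite -scalerBr; apply/lspan_predP/rpredZ/lspan_predP.
by apply/qproj_eq; rewrite qreprK.
Qed.

Fact qscaleA a b x : qscale a (qscale b x) = qscale (a * b) x.
Proof. by rewrite -[x]qreprK -!qprojZ scalerA. Qed.
Fact qscale1 : left_id 1 qscale.
Proof. by move=> x; rewrite -[x]qreprK -!qprojZ scale1r. Qed.
Fact qscaleDr : right_distributive qscale +%R.
Proof.
by move=> a x y; rewrite -[x]qreprK -[y]qreprK -qprojD -!qprojZ -qprojD scalerDr.
Qed.
Fact qscaleDl x : {morph qscale^~ x : a b / a + b}.
Proof. by move=> a b; rewrite -[x]qreprK -!qprojZ scalerDl qprojD. Qed.

HB.instance Definition _ :=
  GRing.Zmodule_isLmodule.Build k (qmod X) qscaleA qscale1 qscaleDr qscaleDl.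

Fact qproj_is_linear : linear qproj.
Proof. by move=> a u v; rewrite qprojD qprojZ. Qed.

HB.instance Definition _ :=
  GRing.isLinear.Build k V (qmod X) *:%R qproj qproj_is_linear.

(** Total: [qlift f] factors f through the quotient only if f kills X, see
    [qliftE]. *)
Definition qlift (W : lmodType k) (f : V -> W) (x : qmod X) : W := f (qrepr x).

Lemma lspan_ker (W : lmodType k) (f : {linear V -> W}) :
  (forall x, X x -> f x = 0) -> forall x, lspan X x -> f x = 0.
Proof.
move=> fX x; apply: (@smallest_sub _ (@is_subspace k V) X [set x | f x = 0]) => //.
by split=> /= [|a u v fu fv]; rewrite ?linear0 // linearP fu fv scaler0 addr0.
Qed.

Lemma qliftE (W : lmodType k) (f : {linear V -> W}) :
  (forall x, X x -> f x = 0) -> forall v, qlift f (qproj v) = f v.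
Proof.
move=> fX v; apply/eqP; rewrite -subr_eq0 -linearB; apply/eqP.
by apply: (lspan_ker fX); apply/qproj_eq; rewrite qreprK.
Qed.

Lemma qlift_is_linear (W : lmodType k) (f : {linear V -> W}) :
  (forall x, X x -> f x = 0) -> linear (qlift f).
Proof.
move=> fX a x y; rewrite -[x]qreprK -[y]qreprK -linearP !qliftE //.
exact: linearP.
Qed.

Lemma qproj_gen x : X x -> qproj x = 0.
Proof.
by move=> Xx; rewrite -(linear0 qproj); apply/qproj_eq; rewrite subr0;
  apply: sub_gen_smallest.
Qed.

End QuotientModule.

Section FglLinear.
Variables (k : fieldType) (K : choiceType) (W : lmodType k) (f : K -> W).

Fact fglift_is_linear : linear (fglift f : {freeg K / k} -> W).
Proof.
have FB := lift_is_additive f.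
have F0 : fglift f 0 = 0 by rewrite -(subrr 0) FB subrr.
have FN D : fglift f (- D) = - fglift f D by rewrite -sub0r FB F0 sub0r.
have FD D1 D2 : fglift f (D1 + D2) = fglift f D1 + fglift f D2.
  by rewrite -[D2]opprK FB FN !opprK.
have Fsum (s : seq K) (g : K -> {freeg K / k}) :
    fglift f (\sum_(x <- s) g x) = \sum_(x <- s) fglift f (g x).
  by elim: s => [|x s IH]; rewrite ?big_nil ?big_cons ?FD ?IH.
move=> a D1 D2; rewrite FD; congr (_ + _).
rewrite -{2}(freeg_sumE D1) [a *: D1]/(fgscale a D1) /fgscale !Fsum scaler_sumr.
by apply: eq_bigr => x _; rewrite !liftU scalerA.
Qed.

HB.instance Definition _ :=
  GRing.isLinear.Build k {freeg K / k} W *:%R (fglift f) fglift_is_linear.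

End FglLinear.

Notation bilin f := (bilinear_for *:%R *:%R f).

Lemma bilinE (k : fieldType) (U V W : lmodType k) (f : U -> V -> W) : bilin f ->
  [/\ forall v, f 0 v = 0, forall u, f u 0 = 0,
      forall u u' v, f (u + u') v = f u v + f u' v
    & forall u v v', f u (v + v') = f u v + f u v'].
Proof.
move=> [fl fr].
have fDl u u' v : f (u + u') v = f u v + f u' v.
  by have := fl v 1 u u'; rewrite /= !scale1r.
have fDr u v v' : f u (v + v') = f u v + f u v'.
  by have := fr u 1 v v'; rewrite /= !scale1r.
have f0l v : f 0 v = 0 by apply: (addrI (f 0 v)); rewrite -fDl !addr0.
have f0r u : f u 0 = 0 by apply: (addrI (f u 0)); rewrite -fDr !addr0.
by split.
Qed.

Section Tensor.
Variables (k : fieldType) (U V : lmodType k).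

Definition tgen (u : U) (v : V) : {freeg (U * V) / k} := << (u, v) >>.

Definition tensor_rel : set {freeg (U * V) / k} :=
  [set r | exists a u u' v, r = tgen (a *: u + u') v - (a *: tgen u v + tgen u' v)]
  `|`
  [set r | exists a u v v', r = tgen u (a *: v + v') - (a *: tgen u v + tgen u v')].

Definition tensor : Type := qmod tensor_rel.

HB.instance Definition _ := GRing.Lmodule.on tensor.

Definition tens (u : U) (v : V) : tensor := qproj tensor_rel (tgen u v).

(** Total: [tlift f] is the map induced by f only if f is bilinear, see [tliftE]
    and [tlift_linear]. *)
Definition tlift (W : lmodType k) (f : U -> V -> W) : tensor -> W :=
  qlift (fglift (fun p : U * V => f p.1 p.2)).

Lemma tens_bilin : bilin tens.
Proof.
split=> [v|u] a x y; rewrite /tens -linearP; apply/qproj_eq;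
  apply: sub_gen_smallest; [left | right].
- by exists a, x, y, v.
- by exists a, u, x, y.
Qed.

Lemma fglift_rel (W : lmodType k) (f : U -> V -> W) : bilin f ->
  forall r, tensor_rel r -> fglift (fun p : U * V => f p.1 p.2) r = 0.
Proof.
move=> fb r [] [a] [x] [y] [z] ->; rewrite linearB linearP /= /tgen !liftU /= !scale1r.
- by rewrite fb.1 subrr.
- by rewrite fb.2 subrr.
Qed.

Lemma tliftE (W : lmodType k) (f : U -> V -> W) :
  bilin f -> forall u v, tlift f (tens u v) = f u v.
Proof.
move=> fb u v; rewrite /tlift qliftE; last exact: fglift_rel.
by rewrite /= /tgen liftU scale1r.
Qed.

Lemma tlift_linear (W : lmodType k) (f : U -> V -> W) :
  bilin f -> linear (tlift f).
Proof. by move=> fb; apply: qlift_is_linear; apply: fglift_rel. Qed.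

Lemma tensor_sum (x : tensor) :
  exists s : seq (U * V), x = \sum_(p <- s) tens p.1 p.2.
Proof.
exists [seq (coeff p (qrepr x) *: p.1, p.2) | p <- dom (qrepr x)].
rewrite -{1}[x]qreprK -{1}(freeg_sumE (qrepr x)) linear_sum [RHS]big_map.
apply: eq_bigr => -[u v] _ /=; set c := coeff _ _.
have -> : << c *g (u, v) >> = c *: tgen u v.
  by apply/eqP/freeg_eqP => z; rewrite coeffZ !coeffU mul1r.
have tZ : tens (c *: u) v = c *: tens u v.
  have t0 : tens 0 v = 0.
    have /= /eqP := tens_bilin.1 v 1 0 0.
    by rewrite scaler0 addr0 scale1r -subr_eq subrr => /eqP.
  by rewrite -[c *: u]addr0 tens_bilin.1 /= t0 addr0.
by rewrite tZ linearZ.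
Qed.

Lemma tensor_ind (P : tensor -> Prop) :
  P 0 -> (forall u v, P (tens u v)) -> (forall x y, P x -> P y -> P (x + y)) ->
  forall x, P x.
Proof.
move=> P0 Pt PD x; have [s ->] := tensor_sum x.
by elim: s => [|p s IH]; rewrite ?big_nil ?big_cons //; apply: PD.
Qed.

Lemma tlift_morph (W : lmodType k) (f : U -> V -> W) : bilin f ->
  tlift f 0 = 0 /\ {morph tlift f : x y / x + y}.
Proof.
move=> fb; have fD x y : tlift f (x + y) = tlift f x + tlift f y.
  by have := tlift_linear fb 1 x y; rewrite !scale1r.
by split=> //; apply: (addrI (tlift f 0)); rewrite -fD !addr0.
Qed.

Lemma tlift_linear_param (T W : lmodType k) (f : T -> U -> V -> W) :
  (forall t, bilin (f t)) -> (forall u v, linear (fun t => f t u v)) ->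
  forall x, linear (fun t => tlift (f t) x).
Proof.
move=> fb fl x a t t'; elim/tensor_ind: x => [|u v|x y].
- by rewrite !(tlift_morph (fb _)).1 scaler0 addr0.
- by rewrite !(tliftE (fb _)) fl.
- by rewrite !(tlift_morph (fb _)).2 => -> ->; rewrite scalerDr addrACA.
Qed.

Lemma tensor_ext (W : lmodType k) (f g : tensor -> W) :
  linear f -> linear g -> (forall u v, f (tens u v) = g (tens u v)) -> f =1 g.
Proof.
move=> fl gl fg x; have [s ->] := tensor_sum x.
pose F : {linear tensor -> W} := HB.pack f (GRing.isLinear.Build _ _ _ _ f fl).
pose G : {linear tensor -> W} := HB.pack g (GRing.isLinear.Build _ _ _ _ g gl).
rewrite -[f]/(F : _ -> _) -[g]/(G : _ -> _) !linear_sum; apply: eq_bigr => p _.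
exact: fg.
Qed.

End Tensor.

Arguments tensor {k} (U V)%_type_scope.
Notation "U ⊗ V" := (tensor U V) : type_scope.
Notation "u ⊗ v" := (tens u v) : ring_scope.

Section TensorMaps.
Variable k : fieldType.
Implicit Types U V W A B X Y : lmodType k.

Lemma tensPl U V a (u u' : U) (v : V) : (a *: u + u') ⊗ v = a *: (u ⊗ v) + u' ⊗ v.
Proof. exact: (tens_bilin U V).1. Qed.

Lemma tensPr U V a (u : U) (v v' : V) : u ⊗ (a *: v + v') = a *: (u ⊗ v) + u ⊗ v'.
Proof. exact: (tens_bilin U V).2. Qed.

Lemma tensDl U V (u u' : U) (v : V) : (u + u') ⊗ v = u ⊗ v + u' ⊗ v.
Proof. by rewrite -[u]scale1r tensPl !scale1r. Qed.

Lemma tensDr U V (u : U) (v v' : V) : u ⊗ (v + v') = u ⊗ v + u ⊗ v'.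
Proof. by rewrite -[v]scale1r tensPr !scale1r. Qed.

Lemma tens0l U V (v : V) : (0 : U) ⊗ v = 0.
Proof. by apply: (addrI (0 ⊗ v)); rewrite -tensDl !addr0. Qed.

Lemma tens0r U V (u : U) : u ⊗ (0 : V) = 0.
Proof. by apply: (addrI (u ⊗ 0)); rewrite -tensDr !addr0. Qed.

Lemma tensZl U V a (u : U) (v : V) : (a *: u) ⊗ v = a *: (u ⊗ v).
Proof. by rewrite -[a *: u]addr0 tensPl tens0l addr0. Qed.

Lemma tensZr U V a (u : U) (v : V) : u ⊗ (a *: v) = a *: (u ⊗ v).
Proof. by rewrite -[a *: v]addr0 tensPr tens0r addr0. Qed.

Definition tmap U V A B (f : U -> A) (g : V -> B) : U ⊗ V -> A ⊗ B :=
  tlift (fun u v => f u ⊗ g v).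

Lemma tmap_bilin U V A B (f : {linear U -> A}) (g : {linear V -> B}) :
  bilin (fun u v => f u ⊗ g v).
Proof. by split=> ? a x y; rewrite linearP (tensPl, tensPr). Qed.

HB.instance Definition _ U V A B (f : {linear U -> A}) (g : {linear V -> B}) :=
  GRing.isLinear.Build k (U ⊗ V)%type (A ⊗ B)%type *:%R (tmap f g)
    (tlift_linear (tmap_bilin f g)).

Lemma tmapE U V A B (f : {linear U -> A}) (g : {linear V -> B}) u v :
  tmap f g (u ⊗ v) = f u ⊗ g v.
Proof. exact: (tliftE (tmap_bilin f g)). Qed.

Lemma tmap_id U V (x : U ⊗ V) : tmap idfun idfun x = x.
Proof.
apply: (tensor_ext (g := id) (linearP _)) => [//|u v]; exact: tmapE.
Qed.

Lemma tmap_comp U V A B X Y (f' : {linear A -> X}) (f : {linear U -> A})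
    (g' : {linear B -> Y}) (g : {linear V -> B}) x :
  tmap f' g' (tmap f g x) = tmap (f' \o f) (g' \o g) x.
Proof.
apply: (tensor_ext (f := tmap f' g' \o tmap f g)); try exact: linearP.
by move=> u v /=; rewrite !tmapE.
Qed.

Definition tassoc U V W : (U ⊗ V) ⊗ W -> U ⊗ (V ⊗ W) :=
  tlift (fun x w => tlift (fun u v => u ⊗ (v ⊗ w)) x).

Section Assoc.
Variables U V W : lmodType k.

Fact tassoc_bilin1 (w : W) : bilin (fun (u : U) (v : V) => u ⊗ (v ⊗ w)).
Proof.
split=> [v|u] a x y; first by rewrite tensPl.
by rewrite tensPl tensPr.
Qed.

Fact tassoc_bilin2 :
  bilin (fun (x : U ⊗ V) (w : W) => tlift (fun u v => u ⊗ (v ⊗ w)) x).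
Proof.
split=> [w|x]; first exact: (tlift_linear (tassoc_bilin1 w)).
apply: (tlift_linear_param tassoc_bilin1) => u v a w w'.
by rewrite !tensPr.
Qed.

HB.instance Definition _ :=
  GRing.isLinear.Build k ((U ⊗ V) ⊗ W)%type (U ⊗ (V ⊗ W))%type *:%R
    (@tassoc U V W) (tlift_linear tassoc_bilin2).

Lemma tassocE (u : U) (v : V) (w : W) : tassoc ((u ⊗ v) ⊗ w) = u ⊗ (v ⊗ w).
Proof. by rewrite /tassoc (tliftE tassoc_bilin2) (tliftE (tassoc_bilin1 w)). Qed.

End Assoc.

Lemma tassoc_ext U V W X (f g : {linear ((U ⊗ V) ⊗ W)%type -> X}) :
  (forall u v w, f ((u ⊗ v) ⊗ w) = g ((u ⊗ v) ⊗ w)) -> f =1 g.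
Proof.
move=> fg; apply: tensor_ext => [||x w]; try exact: linearP.
elim/tensor_ind: x => [|//|x y].
- by rewrite tens0l !linear0.
- by rewrite tensDl !linearD => -> ->.
Qed.

Lemma tassoc_nat U V W A B X (f : {linear U -> A}) (g : {linear V -> B})
    (h : {linear W -> X}) x :
  tassoc (tmap (tmap f g) h x) = tmap f (tmap g h) (tassoc x).
Proof.
apply: (tassoc_ext (f := @tassoc A B X \o tmap (tmap f g) h)
                   (g := tmap f (tmap g h) \o @tassoc U V W)) => u v w /=.
by rewrite tassocE !tmapE /= !tmapE tassocE.
Qed.

(** (a ⊗ a') ∘ (id ⊗ τ ⊗ id), that is (u ⊗ u', v ⊗ v') ↦ a(u,v) ⊗ a'(u',v'). *)
Definition tbimap U U' V V' A A' (a : U -> V -> A) (a' : U' -> V' -> A')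
    (x : U ⊗ U') (y : V ⊗ V') : A ⊗ A' :=
  tlift (fun u u' => tlift (fun v v' => a u v ⊗ a' u' v') y) x.

Section Bimap.
Variables U U' V V' A A' : lmodType k.
Variables (a : U -> V -> A) (a' : U' -> V' -> A').
Hypotheses (ab : bilin a) (ab' : bilin a').

Fact tbimap_bilin1 u u' : bilin (fun v v' => a u v ⊗ a' u' v').
Proof. by split=> ? c x y; rewrite (ab, ab') (tensPl, tensPr). Qed.

Fact tbimap_bilin2 (y : V ⊗ V') :
  bilin (fun u u' => tlift (fun v v' => a u v ⊗ a' u' v') y).
Proof.
split=> [u'|u].
- apply: (tlift_linear_param (fun u => tbimap_bilin1 u u')) => v v' c x z.
  by rewrite ab.1 tensPl.
- apply: (tlift_linear_param (tbimap_bilin1 u)) => v v' c x z.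
  by rewrite ab'.1 tensPr.
Qed.

Lemma tbimap_bilin : bilin (tbimap a a').
Proof.
split=> [y|x]; first exact: (tlift_linear (tbimap_bilin2 y)).
apply: (tlift_linear_param tbimap_bilin2) => u u'.
exact: (tlift_linear (tbimap_bilin1 u u')).
Qed.

Lemma tbimapE u u' v v' :
  tbimap a a' (u ⊗ u') (v ⊗ v') = a u v ⊗ a' u' v'.
Proof.
by rewrite /tbimap (tliftE (tbimap_bilin2 _)) (tliftE (tbimap_bilin1 _ _)).
Qed.

End Bimap.

End TensorMaps.

HB.mixin Record Lmodule_isCoalgebra (k : fieldType) C of GRing.Lmodule k C := {
  comul_subdef : {linear C -> (C ⊗ C)%type};
  counit_subdef : {linear C -> k^o};
  comulA_subproof : forall c,
    tassoc (tmap comul_subdef idfun (comul_subdef c)) =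
    tmap idfun comul_subdef (comul_subdef c);
  counitl_subproof : forall c,
    tlift (fun c1 c2 => (counit_subdef c1 : k) *: c2) (comul_subdef c) = c;
  counitr_subproof : forall c,
    tlift (fun c1 c2 => (counit_subdef c2 : k) *: c1) (comul_subdef c) = c
}.

#[short(type="coalgType")]
HB.structure Definition Coalgebra (k : fieldType) :=
  {C of Lmodule_isCoalgebra k C & GRing.Lmodule k C}.

Section CoalgebraTheory.
Variables (k : fieldType) (C : coalgType k).

Definition comul : {linear C -> (C ⊗ C)%type} := comul_subdef.
Definition counit : {scalar C} := counit_subdef.

Lemma comulA (c : C) :
  tassoc (tmap comul idfun (comul c)) = tmap idfun comul (comul c).
Proof. exact: comulA_subproof. Qed.

Lemma counitl (c : C) : tlift (fun c1 c2 : C => counit c1 *: c2) (comul c) = c.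
Proof. exact: counitl_subproof. Qed.

Lemma counitr (c : C) : tlift (fun c1 c2 : C => counit c2 *: c1) (comul c) = c.
Proof. exact: counitr_subproof. Qed.

End CoalgebraTheory.

Arguments comul {k C}.
Arguments counit {k C}.

(** The product m ∘ (f ⊗ g) ∘ Δ of the convolution algebra Hom_k(C, A), with unit
    η ∘ ε. *)
Definition conv (k : fieldType) (C : coalgType k) (A : algType k) (f g : C -> A)
    (c : C) : A :=
  tlift (fun c1 c2 => f c1 * g c2) (comul c).

Definition conv1 (k : fieldType) (C : coalgType k) (A : algType k) (c : C) : A :=
  (counit c)%:A.

(** [tbimap *%R *%R] is the multiplication of the algebra H ⊗ H. *)
HB.mixin Record isBialgebra (k : fieldType) H
    of GRing.Algebra k H & Coalgebra k H := {
  comulM_subproof : forall x y : H,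
    comul (x * y) = tbimap *%R *%R (comul x) (comul y);
  comul1_subproof : comul (1 : H) = (1 : H) ⊗ (1 : H);
  counitM_subproof : forall x y : H, counit (x * y) = counit x * counit y;
  counit1_subproof : counit (1 : H) = 1
}.

#[short(type="bialgType")]
HB.structure Definition Bialgebra (k : fieldType) :=
  {H of isBialgebra k H & GRing.Algebra k H & Coalgebra k H}.

Section BialgebraTheory.
Variables (k : fieldType) (H : bialgType k).

Lemma comulM (x y : H) : comul (x * y) = tbimap *%R *%R (comul x) (comul y).
Proof. exact: comulM_subproof. Qed.

Lemma comul1 : comul (1 : H) = (1 : H) ⊗ (1 : H).
Proof. exact: comul1_subproof. Qed.

Lemma counitM (x y : H) : counit (x * y) = counit x * counit y.
Proof. exact: counitM_subproof. Qed.

Lemma counit1 : counit (1 : H) = 1.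
Proof. exact: counit1_subproof. Qed.

End BialgebraTheory.

HB.mixin Record isHopf (k : fieldType) H of Bialgebra k H := {
  antipode_subdef : {linear H -> H};
  antipodel_subproof : forall x : H, conv antipode_subdef idfun x = conv1 H x;
  antipoder_subproof : forall x : H, conv idfun antipode_subdef x = conv1 H x
}.

#[short(type="hopfAlgType")]
HB.structure Definition HopfAlgebra (k : fieldType) :=
  {H of isHopf k H & Bialgebra k H}.

Section HopfTheory.
Variables (k : fieldType) (H : hopfAlgType k).

Definition antipode : {linear H -> H} := antipode_subdef.

Lemma antipodel (x : H) : conv antipode idfun x = conv1 H x.
Proof. exact: antipodel_subproof. Qed.

Lemma antipoder (x : H) : conv idfun antipode x = conv1 H x.
Proof. exact: antipoder_subproof. Qed.

End HopfTheory.

Arguments antipode {k H}.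

HB.mixin Record isRightModule (k : fieldType) (A : algType k) M
    of GRing.Lmodule k M := {
  ract : M -> A -> M;
  ract_bilin_subproof : bilin ract;
  ractA : forall m a b, ract (ract m a) b = ract m (a * b);
  ract1 : forall m, ract m 1 = m
}.

#[short(type="rightModType")]
HB.structure Definition RightModule (k : fieldType) (A : algType k) :=
  {M of isRightModule k A M & GRing.Lmodule k M}.

Notation "m ◁ a" := (ract m a) (at level 40, left associativity) : ring_scope.

Lemma ract_bilin (k : fieldType) (A : algType k) (M : rightModType A) :
  bilin (ract : M -> A -> M).
Proof. exact: ract_bilin_subproof. Qed.

(** Δ and ε are H-linear for the diagonal action (x ⊗ y) ◁ h = Σ x h_1 ⊗ y h_2 on
    C ⊗ C and the trivial action a ◁ h = a ε(h) on k. *)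
HB.mixin Record isModuleCoalgebra (k : fieldType) (H : hopfAlgType k) C
    of RightModule k H C & Coalgebra k C := {
  comul_ract_subproof : forall (c : C) (h : H),
    comul (c ◁ h) = tbimap ract ract (comul c) (comul h);
  counit_ract : forall (c : C) (h : H), counit (c ◁ h) = counit c * counit h
}.

#[short(type="moduleCoalgType")]
HB.structure Definition ModuleCoalgebra (k : fieldType) (H : hopfAlgType k) :=
  {C of isModuleCoalgebra k H C & RightModule k H C & Coalgebra k C}.

Lemma comul_ract (k : fieldType) (H : hopfAlgType k) (C : moduleCoalgType H)
    (c : C) (h : H) :
  comul (c ◁ h) = tbimap ract ract (comul c) (comul h).
Proof. exact: comul_ract_subproof. Qed.

Section Cbar.
Variables (k : fieldType) (H : hopfAlgType k) (C : moduleCoalgType H).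

Definition CHplus : set C :=
  lspan [set x | exists (c : C) (h : H), counit h = 0 /\ x = c ◁ h].

Definition Cbar : Type := qmod CHplus.

HB.instance Definition _ := GRing.Lmodule.on Cbar.

Definition eta : {linear C -> Cbar} := @qproj k C CHplus.

Definition Cbar_comul : Cbar -> Cbar ⊗ Cbar := qlift (tmap eta eta \o comul).

Definition Cbar_counit : Cbar -> k^o := qlift (counit : C -> k^o).

Lemma eta_ract (c : C) (h : H) : eta (c ◁ h) = counit h *: eta c.
Proof.
have rb : bilin (ract : C -> H -> C) := ract_bilin C.
apply/eqP; rewrite -subr_eq0 -linearZ -linearB /=; apply/eqP.
apply: qproj_gen; apply: sub_gen_smallest; exists c, (h - counit h *: 1).
split; first by rewrite linearB linearZ /= counit1 mulr1 subrr.
by rewrite [h - _]addrC -(scaleNr _ 1) rb.2 /= ract1 scaleNr addrC.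
Qed.

Fact counitM_bilin (D : coalgType k) :
  bilin (fun a b : D => (counit a * counit b : k^o)).
Proof.
split=> [b|a] u x y; rewrite linearP /=.
- by rewrite mulrDl scalerAl.
- by rewrite mulrDr scalerAr.
Qed.

Fact counitl_bilin (D : coalgType k) (W : lmodType k) (f : {linear D -> W}) :
  bilin (fun a b : D => counit a *: f b).
Proof.
split=> [b|a] u x y; rewrite linearP /=.
- by rewrite scalerDl scalerA.
- by rewrite scalerDr !scalerA mulrC.
Qed.

Fact counitr_bilin (D : coalgType k) (W : lmodType k) (f : {linear D -> W}) :
  bilin (fun a b : D => counit b *: f a).
Proof.
split=> [b|a] u x y; rewrite linearP /=.
- by rewrite scalerDr !scalerA mulrC.
- by rewrite scalerDl scalerA.
Qed.

Lemma counit_comul (D : coalgType k) (d : D) :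
  tlift (fun a b : D => (counit a * counit b : k^o)) (comul d) = counit d.
Proof.
pose e : {linear D -> k^o} := counit.
rewrite -[d in RHS](counitl d).
have cb := counitl_bilin (D := D) idfun.
pose F : {linear (D ⊗ D)%type -> D} :=
  HB.pack (tlift (fun a b : D => counit a *: idfun b))
    (GRing.isLinear.Build _ _ _ _ _ (tlift_linear cb)).
apply: (tensor_ext (g := e \o F)); first exact: tlift_linear (counitM_bilin D).
  exact: linearP.
by move=> u v /=; rewrite (tliftE (counitM_bilin D)) (tliftE cb) linearZ.
Qed.

Lemma eta2_ract (x : C ⊗ C) (y : H ⊗ H) :
  tmap eta eta (tbimap ract ract x y) =
  (tlift (fun a b : H => (counit a * counit b : k^o)) y : k) *: tmap eta eta x.
Proof.
have rb : bilin (ract : C -> H -> C) := ract_bilin C; have cb := counitM_bilin H.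
have [b0l b0r bDl bDr] := bilinE (tbimap_bilin rb rb).
elim/tensor_ind: x => [|c c'|x x' IH IH'].
- by rewrite b0l !raddf0.
- elim/tensor_ind: y => [|h h'|y y' IH IH'].
  + by rewrite b0r (tlift_morph cb).1 scale0r raddf0.
  + by rewrite tbimapE // !tmapE (tliftE cb) !eta_ract tensZl tensZr scalerA.
  + by rewrite bDr raddfD /= IH IH' (tlift_morph cb).2 scalerDl.
- by rewrite bDl !raddfD /= IH IH'.
Qed.

Fact Cbar_comul_ker (x : C) : CHplus x -> (tmap eta eta \o comul) x = 0.
Proof.
apply: lspan_ker => _ [c [h [h0 ->]]] /=.
by rewrite comul_ract eta2_ract counit_comul h0 scale0r.
Qed.

Fact Cbar_counit_ker (x : C) : CHplus x -> (counit : {linear C -> k^o}) x = 0.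
Proof.
by apply: lspan_ker => _ [c [h [h0 ->]]] /=; rewrite counit_ract h0 mulr0.
Qed.

HB.instance Definition _ := GRing.isLinear.Build k Cbar (Cbar ⊗ Cbar)%type *:%R
  Cbar_comul (qlift_is_linear Cbar_comul_ker).

HB.instance Definition _ := GRing.isLinear.Build k Cbar k^o *:%R
  Cbar_counit (qlift_is_linear Cbar_counit_ker).

Lemma eta_surj (x : Cbar) : exists c, x = eta c.
Proof. by exists (qrepr x); rewrite /= qreprK. Qed.

Lemma Cbar_comulE : Cbar_comul \o eta = tmap eta eta \o comul.
Proof. by apply/funext => c; apply: (qliftE Cbar_comul_ker). Qed.

Lemma Cbar_counitE c : Cbar_counit (eta c) = counit c.
Proof. exact: (qliftE Cbar_counit_ker). Qed.

Fact Cbar_comulA (x : Cbar) :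
  tassoc (tmap Cbar_comul idfun (Cbar_comul x)) =
  tmap idfun Cbar_comul (Cbar_comul x).
Proof.
have [c ->] := eta_surj x.
rewrite -[Cbar_comul (eta c)]/((Cbar_comul \o eta) c) Cbar_comulE /= !tmap_comp.
have -> : Cbar_comul \o eta = tmap eta eta \o comul := Cbar_comulE.
rewrite -[idfun \o eta]/(eta \o idfun).
by rewrite -!tmap_comp tassoc_nat comulA.
Qed.

Fact Cbar_counitl (x : Cbar) :
  tlift (fun c1 c2 => (Cbar_counit c1 : k) *: c2) (Cbar_comul x) = x.
Proof.
have [c ->] := eta_surj x.
rewrite -[Cbar_comul (eta c)]/((Cbar_comul \o eta) c) Cbar_comulE /=.
rewrite -[in RHS](counitl c); have cb := counitl_bilin (D := C) idfun.
have Cb : bilin (fun a b : Cbar => (Cbar_counit a : k) *: b).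
  split=> [b|a] u y z /=; first by rewrite linearP /= scalerDl scalerA.
  by rewrite scalerDr !scalerA mulrC.
elim/tensor_ind: (comul c) => [|u v|y z IH IH'].
- by rewrite raddf0 (tlift_morph Cb).1 (tlift_morph cb).1 raddf0.
- by rewrite tmapE (tliftE Cb) (tliftE cb) Cbar_counitE linearZ.
- by rewrite raddfD (tlift_morph Cb).2 IH IH' (tlift_morph cb).2 raddfD.
Qed.

Fact Cbar_counitr (x : Cbar) :
  tlift (fun c1 c2 => (Cbar_counit c2 : k) *: c1) (Cbar_comul x) = x.
Proof.
have [c ->] := eta_surj x.
rewrite -[Cbar_comul (eta c)]/((Cbar_comul \o eta) c) Cbar_comulE /=.
rewrite -[in RHS](counitr c); have cb := counitr_bilin (D := C) idfun.
have Cb : bilin (fun a b : Cbar => (Cbar_counit b : k) *: a).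
  split=> [b|a] u y z /=; last by rewrite linearP /= scalerDl scalerA.
  by rewrite scalerDr !scalerA mulrC.
elim/tensor_ind: (comul c) => [|u v|y z IH IH'].
- by rewrite raddf0 (tlift_morph Cb).1 (tlift_morph cb).1 raddf0.
- by rewrite tmapE (tliftE Cb) (tliftE cb) Cbar_counitE linearZ.
- by rewrite raddfD (tlift_morph Cb).2 IH IH' (tlift_morph cb).2 raddfD.
Qed.

HB.instance Definition _ := Lmodule_isCoalgebra.Build k Cbar
  Cbar_comulA Cbar_counitl Cbar_counitr.

End Cbar.

Section Cotensor.
Variables (k : fieldType) (D : coalgType k) (M N : lmodType k).
Variables (rho : {linear M -> (M ⊗ D)%type}) (lam : {linear N -> (D ⊗ N)%type}).

Definition cotensor_pred : {pred (M ⊗ N)%type} :=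
  fun x => tassoc (tmap rho idfun x) - tmap idfun lam x == 0.

Fact cotensor_closed : subsemimod_closed cotensor_pred.
Proof.
split; first split.
- by rewrite /in_mem /= /cotensor_pred !raddf0 addr0.
- move=> x y; rewrite /in_mem /= /cotensor_pred => /eqP Hx /eqP Hy.
  by rewrite !raddfD /= addrACA Hx Hy addr0.
- move=> a x; rewrite /in_mem /= /cotensor_pred => /eqP Hx.
  by rewrite !linearZ /= -scalerDr Hx scaler0.
Qed.

HB.instance Definition _ :=
  GRing.isSubmodClosed.Build k (M ⊗ N)%type cotensor_pred cotensor_closed.

(** M □_D N as the subtype of M ⊗ N on which [cotensor_pred] holds. *)
Record cotensor : Type :=
  Cotensor { cotensor_val : M ⊗ N; _ : cotensor_val \in cotensor_pred }.

HB.instance Definition _ := [isSub for cotensor_val].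
HB.instance Definition _ := [Choice of cotensor by <:].
HB.instance Definition _ :=
  GRing.SubChoice_isSubLmodule.Build k (M ⊗ N)%type cotensor_pred cotensor
    cotensor_closed.

End Cotensor.

Section Can.
Variables (k : fieldType) (H : hopfAlgType k) (C : moduleCoalgType H).

Definition coactr : C -> C ⊗ Cbar C := tmap idfun (@eta k H C) \o comul.
Definition coactl : C -> Cbar C ⊗ C := tmap (@eta k H C) idfun \o comul.

Fact coactr_linear : linear coactr.
Proof. by move=> a x y; rewrite /coactr linearP. Qed.

Fact coactl_linear : linear coactl.
Proof. by move=> a x y; rewrite /coactl linearP. Qed.

HB.instance Definition _ :=
  GRing.isLinear.Build k C (C ⊗ Cbar C)%type *:%R coactr coactr_linear.
HB.instance Definition _ :=
  GRing.isLinear.Build k C (Cbar C ⊗ C)%type *:%R coactl coactl_linear.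

Definition CboxC : Type := cotensor coactr coactl.

HB.instance Definition _ := GRing.Lmodule.on CboxC.

(** c ⊗ b ↦ Σ c_1 ⊗ c_2 b as a map into C ⊗ C; [can] is its corestriction. *)
Definition can_fun : C ⊗ H -> C ⊗ C :=
  tlift (fun (c : C) (b : H) => tmap idfun (fun d => d ◁ b) (comul c)).

Fact ract_linear (b : H) : linear (fun d : C => d ◁ b).
Proof. by move=> a u v; rewrite (ract_bilin C).1. Qed.

Definition ractr (b : H) (c : C) : C := c ◁ b.

HB.instance Definition _ (b : H) :=
  GRing.isLinear.Build k C C *:%R (ractr b) (ract_linear b).

Fact tmapr_bilin (x : C ⊗ C) : linear (fun b : H => tmap idfun (ractr b) x).
Proof.
have rb : bilin (ract : C -> H -> C) := ract_bilin C.
apply: (tlift_linear_param (fun b => tmap_bilin idfun (ractr b))) => u v a b b' /=.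
by rewrite /ractr rb.2 tensPr.
Qed.

Fact can_bilin :
  bilin (fun (c : C) (b : H) => tmap idfun (ractr b) (comul c)).
Proof. by split=> [b|c] a x y; [rewrite !linearP | rewrite /= tmapr_bilin]. Qed.

HB.instance Definition _ := GRing.isLinear.Build k (C ⊗ H)%type (C ⊗ C)%type *:%R
  can_fun (tlift_linear can_bilin).

Lemma can_funE c b : can_fun (c ⊗ b) = tmap idfun (ractr b) (comul c).
Proof. exact: (tliftE can_bilin). Qed.

Fact coactl_ract (c : C) (b : H) :
  coactl (c ◁ b) = tmap (@eta k H C) (ractr b) (comul c).
Proof.
rewrite /coactl /= comul_ract.
have rb : bilin (ract : C -> H -> C) := ract_bilin C.
have cb := counitl_bilin (D := H) idfun.
have [b0l b0r bDl bDr] := bilinE (tbimap_bilin rb rb).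
have [_ r0 _ rD] := bilinE rb.
rewrite -[b in RHS](counitl b); set y := comul b.
elim/tensor_ind: (comul c) => [|u v|z z' IH IH'].
- by rewrite b0l !raddf0.
- elim/tensor_ind: y => [|h h'|y y' IH IH'].
  + by rewrite b0r (tlift_morph cb).1 !tmapE /= /ractr r0 tens0r raddf0.
  + rewrite tbimapE // (tliftE cb) !tmapE /= /ractr eta_ract tensZl -tensZr.
    by rewrite -[counit h *: h']addr0 rb.2 r0 addr0.
  + by rewrite bDr raddfD /= IH IH' (tlift_morph cb).2 !tmapE /= /ractr rD tensDr.
- by rewrite bDl !raddfD /= IH IH'.
Qed.

Fact can_cotensor (x : C ⊗ H) : can_fun x \in cotensor_pred coactr coactl.
Proof.
elim/tensor_ind: x => [|c b|x y]; last by rewrite raddfD; apply: rpredD.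
  by rewrite raddf0 rpred0.
rewrite /in_mem /= /cotensor_pred can_funE subr_eq0 !tmap_comp.
have -> : coactl \o ractr b = tmap (@eta k H C) (ractr b) \o comul.
  by apply/funext => d; rewrite /= coactl_ract.
by rewrite -(tmap_comp idfun idfun) -comulA -tassoc_nat tmap_comp.
Qed.

Definition can (x : C ⊗ H) : CboxC := Cotensor (can_cotensor x).

Fact can_is_linear : linear can.
Proof. by move=> a x y; apply: val_inj; rewrite /= linearP. Qed.

HB.instance Definition _ :=
  GRing.isLinear.Build k (C ⊗ H)%type CboxC *:%R can can_is_linear.

End Can.

Arguments can {k H} C _.

Section Subcoalgebras.
Variables (k : fieldType) (C : coalgType k).
Implicit Types D E : set C.

(** The image of D ⊗ D in C ⊗ C; over a field D ⊗ D embeds in C ⊗ C. *)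
Definition tensor2 D : set (C ⊗ C) :=
  lspan [set x | exists d d', [/\ D d, D d' & x = d ⊗ d']].

Definition is_subcoalgebra D : Prop :=
  is_subspace D /\ forall d, D d -> tensor2 D (comul d).

Definition is_simple_subcoalgebra D : Prop :=
  [/\ is_subcoalgebra D, exists2 d, D d & d != 0
    & forall E, is_subcoalgebra E -> E `<=` D -> E = [set 0] \/ E = D].

Definition coradical : set C :=
  lspan (\bigcup_(D in is_simple_subcoalgebra) D).

Definition grouplike : set C :=
  [set g | comul g = g ⊗ g /\ counit g = 1].

End Subcoalgebras.

Arguments coradical {k} C _.
Arguments grouplike {k} C _.

Section Cocleft.
Variables (k : fieldType) (H : hopfAlgType k) (C : moduleCoalgType H).

Definition GCH : set C :=
  lspan (\bigcup_(g in grouplike C) [set x | exists h : H, x = g ◁ h]).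

Definition cocleft : Prop :=
  exists gamma gamma' : {linear C -> H},
    [/\ forall (c : C) (h : H), gamma (c ◁ h) = gamma c * h,
        forall c, conv gamma gamma' c = conv1 H c
      & forall c, conv gamma' gamma c = conv1 H c].

End Cocleft.

Arguments GCH {k H} C _.

(* Main.v *)
(** A pair (γ, γ') of mutually inverse maps, with γ an H-map, is extended from
    subcoalgebras E of C stable under H to all of C by Zorn's lemma.  Injectivity of
    can makes h ↦ gh injective for g group-like.  If g is not in E, then E ∩ gH = 0,
    for otherwise h_1 S(h_2) = ε(h) would put g in E, and one sets γ(gh) = h and
    γ'(gh) = S(h) on gH.  If E contains all group-likes and E ≠ C, the comodule C/E has
    a simple subcomodule; its coefficients form a simple subcoalgebra of G(C)H, hence
    of a single gH.  So the wedge F = {c : Δ(c) ∈ E ⊗ C + C ⊗ gH} is strictly larger than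
    E.  Now F/E is a right Hopf module over gH ≅ H, hence free over H, so F → F/E splits
    H-linearly and γ extends to F; since gH ⊆ E, the inverse extends as well by a
    nilpotency argument. *)
From HB Require Import structures.
Require Import Defs.
From mathcomp Require Import all_boot all_algebra.
From mathcomp Require Import boolp classical_sets.

Set Implicit Arguments.
Unset Strict Implicit.
Unset Printing Implicit Defensive.

Import GRing.Theory.
Local Open Scope classical_set_scope.
Local Open Scope ring_scope.

(** The quotient C / E never appears: a functional on C / E is a functional on C vanishing on E, and
    contracting Δ(c) with it gives the coefficients of the comodule C / E directly as elements of C.
    Subcoalgebras, wedges and tensor products of subspaces are tested by such contractions, and the
    number of terms of a tensor takes the place of a dimension in the search for a simple
    subcomodule.

    The obstacle is that E has a linear but no evident H-stable complement in F. With gH on the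
    right of the wedge, F / E is a right module and a right comodule, and its trivialisation by w ⊗
    b ↦ w b_1 ⊗ g b_2 is inverted with S alone; the mirror wedge would call for the inverse of S.

    A provisional inverse of γ on F has an error vanishing on E, and the convolution square of the
    error vanishes where Δ takes values in E ⊗ C + C ⊗ E. This is why the group-likes have to be
    brought into E before any wedge is formed. *)

(** * Subspaces of a vector space *)

Section Subspaces.
Variables (k : fieldType) (V : lmodType k).
Implicit Types (S T : set V) (u v : V) (a : k).

Lemma subspace_set0 : is_subspace [set 0 : V].
Proof. by split=> // a _ _ -> ->; rewrite scaler0 addr0. Qed.

Lemma subspace0 S : is_subspace S -> S 0. Proof. by case. Qed.

Lemma subspaceZ S a v : is_subspace S -> S v -> S (a *: v).
Proof. by move=> [S0 SL] Sv; rewrite -[_ *: _]addr0; apply: SL. Qed.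

Lemma subspaceD S u v : is_subspace S -> S u -> S v -> S (u + v).
Proof. by move=> [S0 SL] Su Sv; rewrite -[u]scale1r; apply: SL. Qed.

Lemma subspaceB S u v : is_subspace S -> S u -> S v -> S (u - v).
Proof.
by move=> sS Su Sv; apply: subspaceD => //; rewrite -scaleN1r; apply: subspaceZ.
Qed.

Lemma sub_lspan (X : set V) : X `<=` lspan X.
Proof. exact: sub_gen_smallest. Qed.

Lemma lspan_sub (X S : set V) : is_subspace S -> X `<=` S -> lspan X `<=` S.
Proof. exact: smallest_sub. Qed.

Definition setadd S T : set V := [set v | exists s t, [/\ S s, T t & v = s + t]].

Lemma setadd_subspace S T :
  is_subspace S -> is_subspace T -> is_subspace (setadd S T).
Proof.
move=> sS sT; split=> [|a _ _ [s [t [Ss Tt ->]]] [s' [t' [Ss' Tt' ->]]]].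
  by exists 0, 0; rewrite addr0; split=> //; apply: subspace0.
exists (a *: s + s'), (a *: t + t'); split; [exact: sS.2|exact: sT.2|].
by rewrite scalerDr addrACA.
Qed.

Lemma setaddl S T v : is_subspace T -> S v -> setadd S T v.
Proof. by move=> sT Sv; exists v, 0; rewrite addr0; split=> //; case: sT. Qed.

Lemma setaddr S T v : is_subspace S -> T v -> setadd S T v.
Proof. by move=> sS Tv; exists 0, v; rewrite add0r; split=> //; case: sS. Qed.

Lemma preim_subspace (W : lmodType k) (f : {linear V -> W}) (S : set W) :
  is_subspace S -> is_subspace (f @^-1` S).
Proof.
move=> sS; split=> /= [|a u v fu fv]; first by rewrite linear0; case: sS.
by rewrite linearP; apply: sS.2.
Qed.

End Subspaces.

(** * Extension of linear maps, projections and separating functionals *)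

Section Extension.
Variables (k : fieldType) (V W : lmodType k).

(** A partial linear map is given by its graph, a subspace of V * W meeting 0 * W only in 0; a graph
    maximal among those with values in [T] is total. Keeping the values in [T] is what later yields
    projections. *)
Lemma linear_extension_into (R : set (V * W)) (T : set W) :
  is_subspace T -> is_subspace R -> (forall w, R (0, w) -> w = 0) ->
  (forall v w, R (v, w) -> T w) ->
  exists f : {linear V -> W}, (forall v w, R (v, w) -> f v = w) /\ forall v, T (f v).
Proof.
move=> sT sR R0 RT.
pose good (X : set (V * W)) :=
  [/\ is_subspace X, forall w, X (0, w) -> w = 0 & forall v w, X (v, w) -> T w].
(* Joining [R] to every set makes the empty chain admissible: its union, joined with [R], is [R]. *)
have [F FP Ftot|A [[sA A0 AT] Amax]] :=
    @Zorn_bigcup (V * W)%type (fun X => good (X `|` R)).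
  set U := _ `|` _.
  have two x y : U x -> U y -> exists Y, [/\ good Y, Y `<=` U, Y x & Y y].
    have Usub X : F X -> X `|` R `<=` U.
      by move=> FX z [Xz|Rz]; [left; exists X | right].
    move=> [[X FX Xx]|Rx] [[Y FY Yy]|Ry].
    - case: (Ftot X Y FX FY) => [XY|YX].
      + by exists (Y `|` R); split; [exact: FP|exact: Usub|left; apply: XY|left].
      + by exists (X `|` R); split; [exact: FP|exact: Usub|left|left; apply: YX].
    - by exists (X `|` R); split; [exact: FP|exact: Usub|left|right].
    - by exists (Y `|` R); split; [exact: FP|exact: Usub|right|left].
    - by exists R; split=> // z; right.
  split; first split; first by right; case: sR.
  - move=> a u v Uu Uv; have [Y [[sY _ _] YU Yu Yv]] := two u v Uu Uv.
    by apply/YU/sY.2.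
  - move=> w Uw; have [Y [[_ Y0 _] _ Yw _]] := two _ _ Uw Uw; exact: Y0.
  - move=> v w Uw; have [Y [[_ _ YT] _ Yw _]] := two _ _ Uw Uw; exact: YT Yw.
set G := A `|` R in sA A0 AT Amax.
have Gfun v w w' : G (v, w) -> G (v, w') -> w = w'.
  move=> Gw Gw'; apply/eqP; rewrite -subr_eq0; apply/eqP/A0.
  by rewrite -(subrr v) -[(_, _)]/((v, w) - (v, w')); apply: subspaceB.
have Gtot v : exists w, G (v, w).
  apply: contrapT => Gv.
  (* [B] is G + k (v, 0), the prolongation with value 0 at v. *)
  pose B : set (V * W) := [set x | exists a, G (x.1 - a *: v, x.2)].
  apply: (Amax B).
    split; first by move=> [x y] Axy; exists 0; rewrite scale0r subr0; left.
    move=> BA; apply: Gv; exists 0; left; apply: BA; exists 1.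
    by rewrite /= scale1r subrr; case: sA.
  have BR : B `|` R = B.
    apply/seteqP; split=> [x [//|Rx]|x]; last by left.
    by exists 0; rewrite scale0r subr0 -surjective_pairing; right.
  rewrite BR; split; first split.
  - by exists 0; rewrite scale0r subr0; case: sA.
  - move=> a [x y] [x' y'] /= [b Gx] [c Gx']; exists (a * b + c) => /=.
    suff -> : (a *: x + x' - (a * b + c) *: v, a *: y + y') =
        a *: (x - b *: v, y) + (x' - c *: v, y') by apply: sA.2.
    by congr (_, _); rewrite /= scalerBr scalerDl scalerA opprD addrACA.
  - move=> w [a /=]; rewrite sub0r; have [->|a0] := eqVneq a 0.
      by rewrite scale0r oppr0; apply: A0.
    move=> Gw; case: Gv; exists (- a^-1 *: w).
    suff -> : (v, - a^-1 *: w) = - a^-1 *: (- (a *: v), w) by apply: subspaceZ.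
    by congr (_, _); rewrite /= scalerN -scaleNr opprK scalerA mulVf ?scale1r.
  - by move=> u w [a /AT].
have [f fG] := choice Gtot.
have fl : linear f.
  move=> a u v; apply: (Gfun (a *: u + v)) => //.
  by rewrite -[(_, _)]/(a *: (u, f u) + (v, f v)); apply: sA.2.
exists (HB.pack f (GRing.isLinear.Build _ _ _ _ f fl) : {linear V -> W}).
by split=> [v w Rvw|v]; [apply: (Gfun v) => //; right|apply: AT (fG v)].
Qed.

Lemma linear_extension (R : set (V * W)) :
  is_subspace R -> (forall w, R (0, w) -> w = 0) ->
  exists f : {linear V -> W}, forall v w, R (v, w) -> f v = w.
Proof.
move=> sR R0; have [||f [fR _]] := @linear_extension_into R setT _ sR R0 => //.
by exists f.
Qed.

Lemma linear_glue (S T : set V) (f g : {linear V -> W}) :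
  is_subspace S -> is_subspace T -> (forall v, S v -> T v -> v = 0) ->
  exists h : {linear V -> W},
    (forall v, S v -> h v = f v) /\ (forall v, T v -> h v = g v).
Proof.
move=> sS sT ST0.
have [|w [s [t [Ss Tt]]]|h hP] := @linear_extension
    [set x | exists s t, [/\ S s, T t & x = (s + t, f s + g t)]].
- split=> [|a _ _ [s [t [Ss Tt ->]]] [s' [t' [Ss' Tt' ->]]]].
    exists 0, 0; rewrite !linear0 !addr0; split=> //; exact: subspace0.
  exists (a *: s + s'), (a *: t + t'); split; [exact: sS.2|exact: sT.2|].
  by rewrite !linearP /=; congr (_, _); rewrite /= scalerDr addrACA.
- move=> [/esym/eqP]; rewrite addr_eq0 => /eqP st ->.
  have t0 : t = 0.
    apply: ST0 => //; rewrite -[t]opprK -st -scaleN1r; exact: subspaceZ.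
  by rewrite st t0 oppr0 !linear0 addr0.
exists h; split=> v Xv; apply: hP.
- by exists v, 0; rewrite linear0 !addr0; split=> //; case: sT.
- by exists 0, v; rewrite linear0 !add0r; split=> //; case: sS.
Qed.

End Extension.

Lemma linear_retraction (k : fieldType) (V W : lmodType k) (i : {linear V -> W}) :
  (forall v, i v = 0 -> v = 0) ->
  exists j : {linear W -> V}, forall v, j (i v) = v.
Proof.
move=> i0; have [|v [u] [/esym/i0 -> ->]//|j jP] :=
    @linear_extension k W V [set x | exists v, x = (i v, v)].
- split=> [|a _ _ [u ->] [v ->]]; first by exists 0; rewrite linear0.
  by exists (a *: u + v); rewrite linearP.
by exists j => v; apply: jP; exists v.
Qed.

Section Separation.
Variables (k : fieldType) (V : lmodType k).

(** [q] acts as the quotient map V → V / S followed by a linear section: its kernel is S, and [q v]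
    represents the class of v. *)
Lemma linear_projection (S : set V) : is_subspace S ->
  exists q : {linear V -> V}, (forall v, S v -> q v = 0) /\ forall v, S (v - q v).
Proof.
move=> sS; have [|w [v [_ [/esym -> ->]]]//|_ _ [v [Sv [_ ->]]]//|p [pS Sp]] :=
  @linear_extension_into k V V [set x | exists v, S v /\ x = (v, v)] S sS.
- split=> [|a _ _ [u [Su ->]] [v [Sv ->]]]; first by exists 0; split=> //; case: sS.
  by exists (a *: u + v); split=> //; apply: sS.2.
exists (idfun \- p); split=> v /= => [Sv|]; last by rewrite opprB addrC subrK.
by rewrite (pS v v) ?subrr //; exists v.
Qed.

Lemma functional_separation (S : set V) (v : V) : is_subspace S -> ~ S v ->
  exists f : {linear V -> k^o}, (forall s, S s -> f s = 0) /\ f v = 1.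
Proof.
move=> sS Sv; have [|w [a [s [Ss]]]|f fP] := @linear_extension k V k^o
    [set x | exists a s, S s /\ x = (a *: v + s, a)].
- split=> [|a _ _ [b [s [Ss ->]]] [c [t [St ->]]]].
    by exists 0, 0; rewrite scale0r addr0; split=> //; case: sS.
  exists (a * b + c), (a *: s + t); split; first exact: sS.2.
  by congr (_, _); rewrite /= scalerDr scalerA scalerDl addrACA.
- move=> [/esym e ->]; apply: contrapT => /eqP a0; apply: Sv.
  move/eqP: e; rewrite addr_eq0 => /eqP e.
  have -> : v = - a^-1 *: s.
    by rewrite scaleNr -scalerN -e scalerA mulVf // scale1r.
  exact: subspaceZ.
exists f; split=> [s Ss|]; apply: fP.
- by exists 0, s; rewrite scale0r add0r.
- by exists 1, 0; rewrite scale1r addr0; split=> //; case: sS.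
Qed.

Lemma functional_ext (v : V) : (forall f : {linear V -> k^o}, f v = 0) -> v = 0.
Proof.
move=> fv; apply: contrapT => v0.
have [//|f [_ f1]] := @functional_separation [set 0] v (subspace_set0 V).
by move: f1; rewrite fv => /esym/eqP; rewrite oner_eq0.
Qed.

End Separation.

(* Opaque, so that simplification keeps [tlin] folded. *)
Lemma tlin_sig (k : fieldType) (U V W : lmodType k) (f : U -> V -> W) : bilin f ->
  {g : {linear (U ⊗ V)%type -> W} | forall u v, g (u ⊗ v) = f u v}.
Proof.
move=> fb.
pose g : {linear (U ⊗ V)%type -> W} :=
  HB.pack (tlift f) (GRing.isLinear.Build _ _ _ _ _ (tlift_linear fb)).
by exists g; apply: tliftE.
Qed.

Definition tlin (k : fieldType) (U V W : lmodType k) (f : U -> V -> W)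
    (fb : bilin f) : {linear (U ⊗ V)%type -> W} := sval (tlin_sig fb).

Lemma tlinE (k : fieldType) (U V W : lmodType k) (f : U -> V -> W)
    (fb : bilin f) u v : tlin fb (u ⊗ v) = f u v.
Proof. exact: (svalP (tlin_sig fb)). Qed.

Lemma tlift_tlin (k : fieldType) (U V W : lmodType k) (f : U -> V -> W)
    (fb : bilin f) x : tlift f x = tlin fb x.
Proof.
apply: tensor_ext => [||u v]; [exact: tlift_linear|exact: linearP|].
by rewrite tliftE // tlinE.
Qed.

Lemma linear_tensor_ext (k : fieldType) (U V W : lmodType k)
    (f g : {linear (U ⊗ V)%type -> W}) :
  (forall u v, f (u ⊗ v) = g (u ⊗ v)) -> f =1 g.
Proof. by apply: tensor_ext; apply: linearP. Qed.

Lemma tensNl (k : fieldType) (U V : lmodType k) (u : U) (v : V) :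
  (- u) ⊗ v = - (u ⊗ v).
Proof. by rewrite -scaleN1r tensZl scaleN1r. Qed.

Lemma tensNr (k : fieldType) (U V : lmodType k) (u : U) (v : V) :
  u ⊗ (- v) = - (u ⊗ v).
Proof. by rewrite -scaleN1r tensZr scaleN1r. Qed.

(** * Slices of tensors by functionals *)

Section Slices.
Variables (k : fieldType) (U V : lmodType k).

Fact slicel_bilin (f : {linear U -> k^o}) : bilin (fun (u : U) (v : V) => f u *: v).
Proof.
split=> [v|u] a x y /=; first by rewrite linearP scalerDl scalerA.
by rewrite scalerDr !scalerA mulrC.
Qed.

Fact slicer_bilin (f : {linear V -> k^o}) : bilin (fun (u : U) (v : V) => f v *: u).
Proof.
split=> [v|u] a x y /=; last by rewrite linearP scalerDl scalerA.
by rewrite scalerDr !scalerA mulrC.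
Qed.

Definition slicel f : {linear (U ⊗ V)%type -> V} := tlin (slicel_bilin f).
Definition slicer f : {linear (U ⊗ V)%type -> U} := tlin (slicer_bilin f).

Lemma slicelE f u v : slicel f (u ⊗ v) = f u *: v. Proof. exact: tlinE. Qed.
Lemma slicerE f u v : slicer f (u ⊗ v) = f v *: u. Proof. exact: tlinE. Qed.

Lemma slicelr (f : {linear U -> k^o}) (g : {linear V -> k^o}) x :
  g (slicel f x) = f (slicer g x).
Proof.
apply: (@linear_tensor_ext k U V k^o (g \o slicel f) (f \o slicer g)) => u v /=.
by rewrite slicelE slicerE !linearZ /= [RHS]mulrC.
Qed.

Definition tensor_sub (S : set U) (T : set V) : set (U ⊗ V) :=
  lspan [set x | exists u v, [/\ S u, T v & x = u ⊗ v]].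

Lemma tensor_sub_subspace S T : is_subspace (tensor_sub S T).
Proof. exact: lspan_subspace. Qed.

Lemma tensor_sub_gen (S : set U) (T : set V) u v :
  S u -> T v -> tensor_sub S T (u ⊗ v).
Proof. by move=> Su Tv; apply: sub_lspan; exists u, v. Qed.

Lemma tensor_subS (S S' : set U) (T T' : set V) :
  S `<=` S' -> T `<=` T' -> tensor_sub S T `<=` tensor_sub S' T'.
Proof.
move=> SS TT; apply: lspan_sub => [|_ [u [v [Su Tv ->]]]]; first exact: lspan_subspace.
by apply: tensor_sub_gen; [apply: SS|apply: TT].
Qed.

Lemma tensor_sub_ker (W : lmodType k) (f : {linear (U ⊗ V)%type -> W})
    (S : set U) (T : set V) :
  (forall u v, S u -> T v -> f (u ⊗ v) = 0) -> forall x, tensor_sub S T x -> f x = 0.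
Proof.
by move=> f0; apply: lspan_ker => _ [u [v [Su Tv ->]]]; apply: f0.
Qed.

(* Induction on the number of terms, enlarging S by one left factor at a time. *)
Lemma slicel_sub (S : set U) (x : U ⊗ V) : is_subspace S ->
  (forall f : {linear U -> k^o}, (forall u, S u -> f u = 0) -> slicel f x = 0) ->
  tensor_sub S setT x.
Proof.
have [s ->] := tensor_sum x; elim: s S => [|[u v] s IH] S sS fx.
  by rewrite big_nil; apply: subspace0; apply: lspan_subspace.
have sX := tensor_sub_subspace S (@setT V).
rewrite big_cons /= in fx *; set y := \sum_(p <- s) _ in IH fx *.
have [Su|Su] := pselect (S u).
  apply: (subspaceD sX); first exact: tensor_sub_gen.
  by apply: IH => // f f0; have := fx f f0; rewrite linearD /= slicelE f0 // scale0r add0r.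
pose S' := setadd S [set w | exists a, w = a *: u].
have sL : is_subspace [set w | exists a, w = a *: u].
  split=> [|c _ _ [a ->] [b ->]]; first by exists 0; rewrite scale0r.
  by exists (c * a + b); rewrite scalerDl scalerA.
have /IH yS' : is_subspace S' by apply: setadd_subspace.
have {yS'} : tensor_sub S' setT y.
  apply: yS' => f f0; have fu : f u = 0.
    by apply: f0; apply: setaddr => //; exists 1; rewrite scale1r.
  have : slicel f (u ⊗ v + y) = 0 by apply: fx => w Sw; apply/f0/setaddl.
  by rewrite linearD /= slicelE fu scale0r add0r.
have : tensor_sub S' setT `<=` [set y | exists w, tensor_sub S setT (y - u ⊗ w)].
  apply: lspan_sub => [|_ [_ [w [[u1 [_ [Su1 [a ->] ->]]] _ ->]]]].
    split=> [|a z1 z2 [w1 zw1] [w2 zw2]].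
      by exists 0; rewrite tens0r subr0; case: sX.
    exists (a *: w1 + w2); rewrite tensPr opprD addrACA -scalerBr.
    exact: sX.2.
  exists (a *: w); rewrite tensDl tensZl tensZr addrK.
  exact: tensor_sub_gen.
move=> H /H {H} [w yw].
(* Slicing by [f] gives v + w = 0, so the two terms with left factor u cancel modulo S ⊗ V. *)
have [f [fS fu]] := functional_separation sS Su.
have fy : slicel f y = w.
  apply/eqP; rewrite -subr_eq0 -[w in X in _ - X]scale1r -fu -slicelE -linearB.
  by apply/eqP; apply: tensor_sub_ker yw => u' v' Su' _; rewrite slicelE fS // scale0r.
have := fx f fS; rewrite linearD /= slicelE fu scale1r fy => vw.
by move: yw; rewrite -[w](addKr v) vw addr0 tensNr opprK addrC.
Qed.

Lemma slicel0 (x : U ⊗ V) : (forall f, slicel f x = 0) -> x = 0.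
Proof.
move=> fx; suff : tensor_sub [set 0] setT x.
  apply: (tensor_sub_ker (f := idfun)) => u v -> _; exact: tens0l.
by apply: slicel_sub => //; apply: subspace_set0.
Qed.

Lemma slicer0 (x : U ⊗ V) : (forall f, slicer f x = 0) -> x = 0.
Proof.
move=> fx; apply: slicel0 => f; apply: functional_ext => g.
by rewrite slicelr fx linear0.
Qed.

End Slices.

Arguments slicel {k U V} f.
Arguments slicer {k U V} f.

Lemma slicel_tmap (k : fieldType) (U V A B : lmodType k) (p : {linear U -> A})
    (q : {linear V -> B}) (f : {linear A -> k^o}) x :
  slicel f (tmap p q x) = q (slicel (f \o p) x).
Proof.
apply: (@linear_tensor_ext _ _ _ _ (slicel f \o tmap p q) (q \o slicel (f \o p))).
by move=> u v /=; rewrite tmapE !slicelE linearZ.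
Qed.

Lemma slicer_tmap (k : fieldType) (U V A B : lmodType k) (p : {linear U -> A})
    (q : {linear V -> B}) (f : {linear B -> k^o}) x :
  slicer f (tmap p q x) = p (slicer (f \o q) x).
Proof.
apply: (@linear_tensor_ext _ _ _ _ (slicer f \o tmap p q) (p \o slicer (f \o q))).
by move=> u v /=; rewrite tmapE !slicerE linearZ.
Qed.

(** With [q] the projection along T, the slices of (id ⊗ q)(x) by functionals killing S vanish, so
    (id ⊗ q)(x) lies in S ⊗ V; the remainder x - (id ⊗ q)(x) lies in U ⊗ T. *)
Lemma slicel_wedge (k : fieldType) (U V : lmodType k) (S : set U) (T : set V)
    (x : U ⊗ V) : is_subspace S -> is_subspace T ->
  (forall f : {linear U -> k^o}, (forall u, S u -> f u = 0) -> T (slicel f x)) ->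
  exists y, tensor_sub S setT (x - y) /\ tensor_sub setT T y.
Proof.
move=> sS sT fx; have [q [qT Tq]] := linear_projection sT.
exists (x - tmap idfun q x); split.
  rewrite opprB addrC subrK; apply: slicel_sub => // f f0.
  by rewrite slicel_tmap qT //; apply: fx.
have sX := tensor_sub_subspace (@setT U) T.
elim/tensor_ind: x {fx} => [|u v|x y IH IH'].
- by rewrite linear0 subr0; case: sX.
- rewrite tmapE /= -scaleN1r -tensZr scaleN1r -tensDr; exact: tensor_sub_gen.
- by rewrite linearD opprD addrACA; apply: (subspaceD sX).
Qed.

Lemma eq_slicel (k : fieldType) (U V : lmodType k) (f g : {linear U -> k^o}) :
  f =1 g -> slicel f =1 slicel g :> (U ⊗ V -> V).
Proof. by move=> fg; apply: linear_tensor_ext => u v; rewrite !slicelE fg. Qed.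

Lemma eq_slicer (k : fieldType) (U V : lmodType k) (f g : {linear V -> k^o}) :
  f =1 g -> slicer f =1 slicer g :> (U ⊗ V -> U).
Proof. by move=> fg; apply: linear_tensor_ext => u v; rewrite !slicerE fg. Qed.

Lemma functional_eq (k : fieldType) (V : lmodType k) (u v : V) :
  (forall f : {linear V -> k^o}, f u = f v) -> u = v.
Proof.
move=> uv; apply/eqP; rewrite -subr_eq0; apply/eqP/functional_ext => f.
by rewrite linearB uv subrr.
Qed.

(** * The two actions of the dual algebra, and subcoalgebras *)

Section Hits.
Variables (k : fieldType) (C : coalgType k).
Implicit Types (f g h t : {linear C -> k^o}) (c d : C) (D E : set C).

(* The actions c ↼ f = f(c_1) c_2 and f ⇀ c = c_1 f(c_2) of the dual algebra: a
   subspace is a subcoalgebra iff it is stable under both. *)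
Definition hitl f (c : C) : C := slicel f (comul c).
Definition hitr f (c : C) : C := slicer f (comul c).

Fact hitl_linear f : linear (hitl f).
Proof. by move=> a c d; rewrite /hitl !linearP. Qed.

Fact hitr_linear f : linear (hitr f).
Proof. by move=> a c d; rewrite /hitr !linearP. Qed.

HB.instance Definition _ f :=
  GRing.isLinear.Build k C C *:%R (hitl f) (hitl_linear f).
HB.instance Definition _ f :=
  GRing.isLinear.Build k C C *:%R (hitr f) (hitr_linear f).

Lemma hitl_counit c : hitl (counit : {linear C -> k^o}) c = c.
Proof. by rewrite -[RHS]counitl (tlift_tlin (slicel_bilin C counit)). Qed.

Lemma hitr_counit c : hitr (counit : {linear C -> k^o}) c = c.
Proof. by rewrite -[RHS]counitr (tlift_tlin (slicer_bilin C counit)). Qed.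

Lemma hitlr f g c : g (hitl f c) = f (hitr g c).
Proof. exact: slicelr. Qed.

Lemma counit_hitl f c : counit (hitl f c) = f c.
Proof. by rewrite (hitlr f counit) hitr_counit. Qed.

Lemma comul_hitr f c : comul (hitr f c) = tmap idfun (hitr f) (comul c).
Proof.
have sE x : comul (slicer f x : C) = slicer f (tmap comul (@idfun C) x).
  apply: (@linear_tensor_ext _ _ _ _ (comul \o slicer f)
    (slicer f \o tmap comul (@idfun C))) => u v /=.
  by rewrite tmapE !slicerE linearZ.
have sA x : slicer f x = tmap (@idfun C) (slicer f : {linear (C ⊗ C)%type -> C}) (tassoc x).
  apply: (@tassoc_ext _ _ _ _ _ (slicer f) (tmap idfun (slicer f) \o @tassoc _ C C C)).
  by move=> u v w /=; rewrite tassocE tmapE !slicerE tensZr.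
by rewrite /hitr sE sA comulA tmap_comp.
Qed.

Lemma comul_hitl f c : comul (hitl f c) = tmap (hitl f) idfun (comul c).
Proof.
have sE x : comul (slicel f x : C) = slicel f (tmap (@idfun C) comul x).
  apply: (@linear_tensor_ext _ _ _ _ (comul \o slicel f)
    (slicel f \o tmap (@idfun C) comul)) => u v /=.
  by rewrite tmapE !slicelE linearZ.
have sA x : slicel f (tassoc x) = tmap (slicel f : {linear (C ⊗ C)%type -> C}) (@idfun C) x.
  apply: (@tassoc_ext _ _ _ _ _ (slicel f \o @tassoc _ C C C) (tmap (slicel f) idfun)).
  by move=> u v w /=; rewrite tassocE tmapE !slicelE tensZl.
by rewrite /hitl sE -comulA sA tmap_comp.
Qed.

(** In the dual algebra [f \o hitr g] is the convolution product f * g, and likewise [f \o hitl g]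
    is g * f. *)
Lemma hitr_hitr f g c : hitr f (hitr g c) = hitr (f \o hitr g) c.
Proof. by rewrite -[LHS]/(slicer f (comul (hitr g c))) comul_hitr slicer_tmap. Qed.

Lemma hitl_hitl f g c : hitl f (hitl g c) = hitl (f \o hitl g) c.
Proof. by rewrite -[LHS]/(slicel f (comul (hitl g c))) comul_hitl slicel_tmap. Qed.

Lemma hitl_hitr f g c : hitl f (hitr g c) = hitr g (hitl f c).
Proof. rewrite -[LHS]/(slicel f (comul (hitr g c))) comul_hitr slicel_tmap.
by congr (hitr g _); apply: eq_slicel. Qed.

Definition hit_closed D : Prop :=
  [/\ is_subspace D, forall f d, D d -> D (hitl f d) & forall f d, D d -> D (hitr f d)].

Lemma slicel_tensor_sub (S T : set C) f x : is_subspace T ->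
  tensor_sub S T x -> T (slicel f x).
Proof.
move=> sT; suff H : tensor_sub S T `<=` slicel f @^-1` T by apply: H.
apply: lspan_sub => [|_ [u [v [_ Tv ->]]]]; first exact: preim_subspace.
by rewrite /= slicelE; apply: subspaceZ.
Qed.

Lemma slicer_tensor_sub (S T : set C) f x : is_subspace S ->
  tensor_sub S T x -> S (slicer f x).
Proof.
move=> sS; suff H : tensor_sub S T `<=` slicer f @^-1` S by apply: H.
apply: lspan_sub => [|_ [u [v [Su _ ->]]]]; first exact: preim_subspace.
by rewrite /= slicerE; apply: subspaceZ.
Qed.

(** For the converse, let [q] be the projection along D: (q ⊗ id)Δ(d) and (id ⊗ q)Δ(d) vanish
    because their slices do, hence Δ(d) = (p ⊗ p)Δ(d) for p = id - q, which has values in D. *)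
Lemma subcoalgebraP D : is_subcoalgebra D <-> hit_closed D.
Proof.
split=> [[sD DD]|[sD Dl Dr]].
  split=> // f d /DD Dd; [exact: slicel_tensor_sub Dd|exact: slicer_tensor_sub Dd].
split=> // d Dd; have [q [qD Dq]] := linear_projection sD.
have pE : comul d = tmap (idfun \- q) (idfun \- q) (comul d).
  have q1 : tmap q idfun (comul d) = 0.
    by apply: slicer0 => f; rewrite slicer_tmap qD //; apply: Dr.
  have q2 : tmap idfun q (comul d) = 0.
    by apply: slicel0 => f; rewrite slicel_tmap qD //; apply: Dl.
  have -> : tmap (idfun \- q) (idfun \- q) (comul d) =
      comul d - tmap q idfun (comul d) - tmap idfun q (comul d)
      + tmap q idfun (tmap idfun q (comul d)).
    apply: (@linear_tensor_ext _ _ _ _ _ (idfun \- tmap q idfun \- tmap idfun q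
      \+ (tmap q idfun \o tmap idfun q))) => u v /=.
    by rewrite !tmapE /= tensDr !tensDl !tensNr !tensNl opprK addrA.
  by rewrite q1 q2 (linear0 (tmap q idfun)) !subr0 addr0.
rewrite pE.
have sX : is_subspace (tensor2 D) := tensor_sub_subspace D D.
elim/tensor_ind: (comul d) => [|u v|x y IH IH'].
- by rewrite linear0; case: sX.
- by rewrite tmapE; exact: tensor_sub_gen (Dq u) (Dq v).
- by rewrite linearD; apply: (subspaceD sX).
Qed.

(** By adjunction g(e ↼ f) = f(g ⇀ e) = 0 for every g. So for f killing E the element c ↼ f depends
    only on c modulo E: it is a coefficient of the comodule C / E. *)
Lemma hitl_annihilator E f e :
  hit_closed E -> (forall e, E e -> f e = 0) -> E e -> hitl f e = 0.
Proof.
move=> [_ _ Er] fE Ee; apply: functional_ext => g; rewrite hitlr fE //.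
exact: Er.
Qed.

Lemma hitr_annihilator E f e :
  hit_closed E -> (forall e, E e -> f e = 0) -> E e -> hitr f e = 0.
Proof.
move=> [_ El _] fE Ee; apply: functional_ext => g; rewrite -hitlr fE //.
exact: El.
Qed.

Lemma hit_closed0 : hit_closed [set 0].
Proof.
split=> [|f _ ->|f _ ->]; rewrite /= ?linear0 //.
exact: subspace_set0.
Qed.

Lemma hit_closedD D E : hit_closed D -> hit_closed E -> hit_closed (setadd D E).
Proof.
move=> [sD Dl Dr] [sE El Er]; split; first exact: setadd_subspace.
- move=> f _ [d [e [Dd Ee ->]]]; rewrite linearD.
  by exists (hitl f d), (hitl f e); split=> //; [apply: Dl|apply: El].
- move=> f _ [d [e [Dd Ee ->]]]; rewrite linearD.
  by exists (hitr f d), (hitr f e); split=> //; [apply: Dr|apply: Er].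
Qed.

Lemma hit_closedI D E : hit_closed D -> hit_closed E -> hit_closed (D `&` E).
Proof.
move=> [sD Dl Dr] [sE El Er]; split.
- split; first by split; [case: sD|case: sE].
  by move=> a u v [Du Eu] [Dv Ev]; split; [apply: sD.2|apply: sE.2].
- by move=> f d [Dd Ed]; split; [apply: Dl|apply: El].
- by move=> f d [Dd Ed]; split; [apply: Dr|apply: Er].
Qed.

(* If f vanishes on Y and agrees with ε on A, then f ⇀ a = a for a in A, while
   f ⇀ Y = 0. *)
Lemma disjoint_setadd A Y Z : hit_closed A -> hit_closed Y -> hit_closed Z ->
  A `&` Y `<=` [set 0] -> A `&` Z `<=` [set 0] -> A `&` setadd Y Z `<=` [set 0].
Proof.
move=> cA cY cZ AY AZ a [Aa [y [z [Yy Zz ayz]]]].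
have [sA _ Ar] := cA; have [sY _ _] := cY; have [sZ _ Zr] := cZ.
have [f [fA fY]] := @linear_glue k C k^o A Y counit \0 sA sY
  (fun v Av Yv => AY v (conj Av Yv)).
have fa : hitr f a = a.
  apply: functional_eq => g; rewrite -hitlr fA ?counit_hitl //.
  by have [_ Al _] := cA; apply: Al.
apply: AZ; split=> //; rewrite -fa ayz linearD /= (hitr_annihilator cY) ?add0r //.
exact: Zr.
Qed.

Lemma hitr0 c : hitr \0 c = 0.
Proof. by apply: functional_eq => h; rewrite linear0 -hitlr. Qed.

Lemma hitrP a f g c : hitr (a \*: f \+ g) c = a *: hitr f c + hitr g c.
Proof. by apply: functional_eq => h; rewrite linearP -!hitlr. Qed.

Lemma hitrB f g c : hitr (f \- g) c = hitr f c - hitr g c.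
Proof.
by apply: functional_eq => h; rewrite linearB -!hitlr.
Qed.

(* The left factors of Δ(x) modulo E ⊗ C, for x with Δ(x) of minimal rank, form a
   basis of a minimal subcomodule of C / E. *)
Lemma minimal_comodule_generator E : hit_closed E -> (exists c, ~ E c) ->
  exists2 x, ~ E x & forall h, ~ E (hitr h x) -> exists t, E (hitr t (hitr h x) - x).
Proof.
move=> [sE El Er] [x0 Ex0].
pose P n := exists x (u v : 'I_n -> C),
  ~ E x /\ tensor_sub E setT (comul x - \sum_i u i ⊗ v i).
have exP : exists n, `[< P n >].
  have [s xs] := tensor_sum (comul x0); exists (size s); apply/asboolP.
  exists x0, (fun i => (nth 0 s i).1), (fun i => (nth 0 s i).2); split=> //.
  rewrite xs (big_nth 0) big_mkord subrr.
  by apply: subspace0; apply: lspan_subspace.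
case: (ex_minnP exP) => n /asboolP [x [u [v [Ex xuv]]]] nmin.
exists x => // h Ey; pose w i := hitr h (v i).
have yuw : tensor_sub E setT (comul (hitr h x) - \sum_i u i ⊗ w i).
  have -> : comul (hitr h x) - \sum_i u i ⊗ w i =
      tmap idfun (hitr h) (comul x - \sum_i u i ⊗ v i).
    rewrite (linearB (tmap idfun (hitr h))) (linear_sum (tmap idfun (hitr h))).
    rewrite comul_hitr; congr (_ - _).
    by apply: eq_bigr => i _; rewrite /= tmapE.
  suff H : tensor_sub E setT `<=` tmap idfun (hitr h) @^-1` tensor_sub E setT by apply: H.
  apply: lspan_sub => [|_ [a [b [Ea _ ->]]]].
    by apply: preim_subspace; apply: lspan_subspace.
  by rewrite /= tmapE; apply: tensor_sub_gen.
(* By minimality of n the w_i are independent, so some functional t has t(w_i) = ε(v_i); then,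
   modulo E, t ⇀ (h ⇀ x) = Σ t(w_i) u_i = Σ ε(v_i) u_i = x. *)
have [|s [a]|t tw] := @linear_extension k C k^o
    [set z | exists a : 'I_n -> k, z = (\sum_i a i *: w i, \sum_i a i * counit (v i) : k^o)].
- split=> [|c _ _ [a ->] [b ->]].
    by exists (fun=> 0); rewrite !big1 // => i _; rewrite (scale0r, mul0r).
  exists (fun i => c * a i + b i); congr (_, _);
    rewrite /= scaler_sumr -big_split; apply: eq_bigr => i _ /=.
    by rewrite scalerDl scalerA.
  by rewrite mulrDl -mulrA.
- case: n => [|n] in u v w xuv yuw nmin a *; first by rewrite !big_ord0 => -[].
  move=> [/esym aw ->]; apply: contrapT => av.
  have [j aj] : exists j, a j != 0.
    apply: contrapT => Na; apply: av; apply: big1 => i _.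
    have [-> |ai] := eqVneq (a i) 0; first by rewrite mul0r.
    by case: Na; exists i.
  (* Eliminating w_j by means of a_j ≠ 0 writes Δ(h ⇀ x), with h ⇀ x still outside E, with one term
     fewer. *)
  suff /nmin : `[< P n >] by rewrite ltnn.
  apply/asboolP; exists (hitr h x), (fun i => u (lift j i) - (a (lift j i) / a j) *: u j),
    (fun i => w (lift j i)); split=> //.
  congr (tensor_sub _ _ (_ - _)): yuw; rewrite (bigD1_ord j) //=.
  have -> : w j = \sum_(i < n) - (a (lift j i) / a j) *: w (lift j i).
    apply: (scalerI aj); rewrite scaler_sumr.
    move/eqP: aw; rewrite (bigD1_ord j) //= addr_eq0 => /eqP ->.
    rewrite -sumrN; apply: eq_bigr => i _.
    by rewrite scalerA mulrN mulrCA divff // mulr1 scaleNr.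
  have -> : u j ⊗ (\sum_(i < n) - (a (lift j i) / a j) *: w (lift j i)) =
      \sum_(i < n) (- (a (lift j i) / a j) *: u j) ⊗ w (lift j i).
    elim/big_rec2: _ => [|i p q _ IH]; first by rewrite tens0r.
    by rewrite tensDr IH tensZr tensZl.
  rewrite -big_split; apply: eq_bigr => i _ /=.
  by rewrite tensDl scaleNr addrC.
have tv i : t (w i) = counit (v i).
  apply: tw; exists (fun l => (l == i)%:R); congr (_, _);
    rewrite (bigD1 i) //= eqxx (scale1r, mul1r) big1 ?addr0 // => l /negPf ->;
    by rewrite (scale0r, mul0r).
pose e : {linear C -> k^o} := counit.
have uvw : slicer t (\sum_i u i ⊗ w i) = slicer e (\sum_i u i ⊗ v i).
  rewrite (linear_sum (slicer t)) (linear_sum (slicer e)).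
  by apply: eq_bigr => i _; rewrite !slicerE tv.
exists t; rewrite -[x in _ - x]hitr_counit -(subrK (slicer t (\sum_i u i ⊗ w i)) (hitr t _)).
rewrite {2}uvw -addrA -[_ - hitr _ x]opprB -(linearB (slicer t)) -(linearB (slicer e)).
by apply: (subspaceB sE); apply: slicer_tensor_sub; eauto.
Qed.

End Hits.

(** * Coefficients of a simple subcomodule of C / E *)

Section Coefficients.
Variables (k : fieldType) (C : coalgType k) (E N : set C).
Implicit Types (f h t : {linear C -> k^o}) (y z : C).

(** The functionals f are those on C / E, so these are the matrix coefficients of the image of N in
    C / E. *)
Definition coefficients : set C :=
  lspan [set c | exists f y, [/\ forall e, E e -> f e = 0, N y & c = hitl f y]].

(** The number of terms is recorded so that it can be minimised over the nonzero elements of a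
    subcoalgebra. *)
Fixpoint coefficient_sum (n : nat) : set C :=
  if n is m.+1 then
    [set c | exists f y c', [/\ forall e, E e -> f e = 0, N y, coefficient_sum m c'
                              & c = hitl f y + c']]
  else [set 0].

Hypotheses (cE : hit_closed E) (sN : is_subspace N).

Lemma coefficients_sum c : coefficients c -> exists n, coefficient_sum n c.
Proof.
have add m n a b : coefficient_sum m a -> coefficient_sum n b ->
    coefficient_sum (m + n) (a + b).
  elim: m a => [|m IH] a /=; first by move=> -> ?; rewrite add0r.
  move=> [f [y [c' [fE Ny c'm ->]]]] bn; exists f, y, (c' + b); split=> //.
    exact: IH.
  by rewrite addrA.
have scale n (a : k) b : coefficient_sum n b -> coefficient_sum n (a *: b).
  elim: n b => [|n IH] b /=; first by move=> ->; rewrite scaler0.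
  move=> [f [y [c' [fE Ny c'n ->]]]]; exists f, (a *: y), (a *: c'); split=> //.
  - exact: subspaceZ.
  - exact: IH.
  - by rewrite linearZ scalerDr.
suff H : coefficients `<=` [set c | exists n, coefficient_sum n c] by apply: H.
apply: lspan_sub => [|_ [f [y [fE Ny ->]]]].
  split=> [|a u v [m um] [n vn]]; first by exists 0%N.
  by exists (m + n)%N; apply: add => //; apply: scale.
by exists 1%N => /=; exists f, y, 0; rewrite addr0.
Qed.

Hypothesis Nr : forall h y, N y -> N (hitr h y).

Lemma coefficient_sum_hitr n h c : coefficient_sum n c -> coefficient_sum n (hitr h c).
Proof.
elim: n c => [|n IH] c /=; first by move=> ->; rewrite linear0.
move=> [f [y [c' [fE Ny c'n ->]]]]; exists f, (hitr h y), (hitr h c').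
by split=> //; [apply: Nr|apply: IH|rewrite linearD hitl_hitr].
Qed.

Lemma coefficients_hit_closed : hit_closed coefficients.
Proof.
have sA : is_subspace coefficients by apply: lspan_subspace.
split=> // f.
- suff H : coefficients `<=` hitl f @^-1` coefficients by [].
  apply: lspan_sub => [|_ [g [y [gE Ny ->]]] /=]; first exact: preim_subspace.
  rewrite hitl_hitl; apply: sub_lspan; exists (f \o hitl g), y; split=> // e Ee /=.
  by rewrite (hitl_annihilator cE) // linear0.
- suff H : coefficients `<=` hitr f @^-1` coefficients by [].
  apply: lspan_sub => [|_ [g [y [gE Ny ->]]] /=]; first exact: preim_subspace.
  by rewrite -hitl_hitr; apply: sub_lspan; exists g, (hitr f y); split=> //; apply: Nr.
Qed.

Hypothesis Nsimple : forall y z, N y -> ~ E y -> N z -> exists t, E (hitr t y - z).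

(* For b = Σ_j y_j ↼ f_j in B with as few terms as possible, h ↦ h ⇀ b and
   h ↦ h ⇀ y_j mod E have the same kernel; so N / E embeds into B as a comodule,
   and the coefficients of N / E lie in B. *)
Lemma coefficients_minimal B b : hit_closed B -> B `<=` coefficients -> B b -> b != 0 ->
  coefficients `<=` B.
Proof.
move=> cB BA Bb b0; have [sE El Er] := cE; have [sB Bl Br] := cB.
pose P n := exists b, [/\ B b, b != 0 & coefficient_sum n b].
have exP : exists n, `[< P n >].
  by have [n bn] := coefficients_sum (BA _ Bb); exists n; apply/asboolP; exists b.
case: (ex_minnP exP) => -[|n] /asboolP [{Bb b0}b [Bb b0 bn]] nmin.
  by move: b0; rewrite bn eqxx.
have [f [y [b' [fE Ny b'n bE]]]] := bn.
(* The two actions commute, so h ⇀ b loses its leading term (h ⇀ y) ↼ f = 0; staying in B with fewer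
   terms, it must vanish. *)
have kill h : E (hitr h y) -> hitr h b = 0.
  move=> Ehy; apply: contrapT => /eqP hb0.
  suff /nmin : `[< P n >] by rewrite ltnn.
  apply/asboolP; exists (hitr h b); split=> //; first exact: Br.
  rewrite bE linearD /= -hitl_hitr (hitl_annihilator cE) // add0r.
  exact: coefficient_sum_hitr.
have Ey : ~ E y.
  by rewrite -[y]hitr_counit => /kill; rewrite hitr_counit; apply/eqP.
have kill' h : hitr h b = 0 -> E (hitr h y).
  move=> hb; apply: contrapT => Ehy.
  (* Some t brings h ⇀ y back to y modulo E; then t * h - ε sends y into E, hence kills b, and b = t
     ⇀ (h ⇀ b) = 0. *)
  have [t] := Nsimple (Nr h Ny) Ehy Ny.
  rewrite hitr_hitr -[y in _ - y]hitr_counit -hitrB => /kill /eqP.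
  rewrite hitrB -hitr_hitr hb linear0 hitr_counit sub0r oppr_eq0.
  by apply/negP.
apply: lspan_sub => // _ [g [z [gE Nz ->]]]; apply: contrapT => Bz.
have [t [tB tz]] := functional_separation sB Bz.
have [h hE] := Nsimple Ny Ey Nz.
(* As t kills the subcoalgebra B, t ⇀ (h ⇀ b) = 0, and this passes from b to y. Then t(z ↼ g) = g(t
   ⇀ z) vanishes, against [tz]. *)
have Ethy : E (hitr t (hitr h y)).
  rewrite hitr_hitr; apply: kill'; rewrite -hitr_hitr.
  by apply: (hitr_annihilator cB) => //; apply: Br.
move: tz; rewrite hitlr -[z](subrK (hitr h y)) linearD linearD.
rewrite (gE _ Ethy) addr0 gE; first by move/esym/eqP; rewrite oner_eq0.
by apply: Er; rewrite -opprB -scaleN1r; apply: subspaceZ.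
Qed.

End Coefficients.

(** [N] is the preimage in C of the simple subcomodule of C / E generated by x. The last two
    conclusions say that x lies in the wedge of E and A but outside E, so that A forces a strictly
    larger domain. *)
Lemma simple_coefficients (k : fieldType) (C : coalgType k) (E : set C) :
  hit_closed E -> (exists c, ~ E c) ->
  exists A x, [/\ is_simple_subcoalgebra A, ~ E x &
    forall f : {linear C -> k^o}, (forall e, E e -> f e = 0) -> A (hitl f x)].
Proof.
move=> cE /(minimal_comodule_generator cE)[x Ex xgen]; have [sE El Er] := cE.
pose N : set C := [set y | exists h, E (y - hitr h x)].
have sN : is_subspace N.
  split=> [|a u v [h uh] [t vt]]; first by exists \0; rewrite sub0r hitr0 oppr0; case: sE.
  exists (a \*: h \+ t); rewrite hitrP opprD addrACA -scalerBr; exact: sE.2.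
have Nr h y : N y -> N (hitr h y).
  move=> [t yt]; exists (h \o hitr t).
  by rewrite -hitr_hitr -linearB; apply: Er.
have Nsimple y z : N y -> ~ E y -> N z -> exists t, E (hitr t y - z).
  move=> [h yh] Ey [h' zh].
  have [|t tE] := xgen h.
    by move=> Eh; apply: Ey; rewrite -[y](subrK (hitr h x)); apply: subspaceD.
  exists (h' \o hitr t); rewrite -hitr_hitr.
  have -> : hitr h' (hitr t y) - z = hitr h' (hitr t (y - hitr h x))
      + hitr h' (hitr t (hitr h x) - x) - (z - hitr h' x).
    by rewrite opprB (linearB (hitr t)) !(linearB (hitr h')) /= !addrA !subrK.
  apply: (subspaceB sE) => //; apply: (subspaceD sE); last exact: Er.
  exact/Er/Er.
have Nx : N x.
  by exists counit; rewrite hitr_counit subrr; case: sE.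
have Ahit (f : {linear C -> k^o}) : (forall e, E e -> f e = 0) ->
    coefficients E N (hitl f x).
  by move=> fE; apply: sub_lspan; exists f, x.
exists (coefficients E N), x; split=> //.
have cA := coefficients_hit_closed cE Nr.
split; first exact/subcoalgebraP.
  have [f [fE fx]] := functional_separation sE Ex.
  exists (hitl f x); first exact: Ahit.
  apply/eqP => fx0; have := counit_hitl f x.
  by rewrite fx0 fx linear0 => /esym/eqP; rewrite oner_eq0.
move=> B /subcoalgebraP cB BA.
have [[b [Bb b0]]|B0] := pselect (exists b, B b /\ b != 0).
  right; apply/seteqP; split=> //.
  exact: (coefficients_minimal cE sN Nr Nsimple cB BA Bb b0).
left; apply/seteqP; split=> [b Bb|_ ->]; last by case: cB => -[].
by apply: contrapT => /eqP b0; apply: B0; exists b.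
Qed.

Lemma eq_tmap (k : fieldType) (U V A B : lmodType k) (f f' : {linear U -> A})
    (g g' : {linear V -> B}) : f =1 f' -> g =1 g' -> tmap f g =1 tmap f' g'.
Proof. by move=> ff gg; apply: linear_tensor_ext => u v /=; rewrite !tmapE ff gg. Qed.

(** * The convolution algebra and the extension of inverses *)

Section Convolution.
Variables (k : fieldType) (C : coalgType k) (A : algType k).
Implicit Types (f g h : {linear C -> A}) (c : C) (E F : set C).

Fact mul_bilin : bilin ( *%R : A -> A -> A).
Proof.
by split=> [b|a] c x y /=; [rewrite mulrDl scalerAl|rewrite mulrDr scalerAr].
Qed.

Definition mulm : {linear (A ⊗ A)%type -> A} := tlin mul_bilin.

Lemma mulmE a b : mulm (a ⊗ b) = a * b. Proof. exact: tlinE. Qed.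

Definition convl f g (c : C) : A := mulm (tmap f g (comul c)).

Fact convl_linear f g : linear (convl f g).
Proof. by move=> a c d; rewrite /convl !linearP. Qed.

HB.instance Definition _ f g :=
  GRing.isLinear.Build k C A *:%R (convl f g) (convl_linear f g).

Lemma conv_convl f g c : conv f g c = convl f g c.
Proof.
have fgb : bilin (fun a b => f a * g b).
  split=> [b|a] x u v /=; first by rewrite linearP mulrDl scalerAl.
  by rewrite linearP mulrDr scalerAr.
rewrite /conv (tlift_tlin fgb) /convl.
apply: (@linear_tensor_ext _ _ _ _ (tlin fgb) (mulm \o tmap f g)) => u v.
by rewrite tlinE /= tmapE mulmE.
Qed.

Lemma convlA f g h : convl (convl f g) h =1 convl f (convl g h).
Proof.
move=> c; rewrite !/convl.
have mA z : mulm (tmap mulm idfun z) = mulm (tmap idfun mulm (tassoc z)).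
  apply: (@tassoc_ext _ _ _ _ _ (mulm \o tmap mulm idfun)
    (mulm \o tmap idfun mulm \o @tassoc _ A A A)) => u v w /=.
  by rewrite tassocE !tmapE !mulmE mulrA.
transitivity (mulm (tmap mulm idfun (tmap (tmap f g) h (tmap comul idfun (comul c))))).
  by rewrite !tmap_comp; congr (mulm _); apply: eq_tmap.
rewrite mA tassoc_nat comulA !tmap_comp; congr (mulm _); exact: eq_tmap.
Qed.

Fact conv1_linear : linear (@conv1 k C A).
Proof. by move=> a c d; rewrite /conv1 linearP scalerDl scalerA. Qed.

HB.instance Definition _ := GRing.isLinear.Build k C A *:%R (@conv1 k C A) conv1_linear.

Local Notation u := (conv1 A : {linear C -> A}).

Lemma convl1l f : convl u f =1 f.
Proof.
pose e : {linear C -> k^o} := counit.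
move=> c; rewrite /convl -[c in RHS]hitl_counit -/e.
have H : mulm \o tmap u f =1 f \o slicel e.
  apply: (@linear_tensor_ext _ _ _ _ (mulm \o tmap u f) (f \o slicel e)) => a b /=.
  by rewrite tmapE mulmE slicelE linearZ -scalerAl mul1r.
exact: H.
Qed.

Lemma convl1r f : convl f u =1 f.
Proof.
pose e : {linear C -> k^o} := counit.
move=> c; rewrite /convl -[c in RHS]hitr_counit -/e.
have H : mulm \o tmap f u =1 f \o slicer e.
  apply: (@linear_tensor_ext _ _ _ _ (mulm \o tmap f u) (f \o slicer e)) => a b /=.
  by rewrite tmapE mulmE slicerE linearZ -scalerAr mulr1.
exact: H.
Qed.

Lemma eq_convl_in E f f' g g' : hit_closed E ->
  (forall c, E c -> f c = f' c) -> (forall c, E c -> g c = g' c) ->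
  forall c, E c -> convl f g c = convl f' g' c.
Proof.
move=> /subcoalgebraP[_ EE] ff gg c /EE Ec; apply/eqP; rewrite -subr_eq0; apply/eqP.
apply: (tensor_sub_ker (f := (mulm \o tmap f g) \- (mulm \o tmap f' g'))) Ec => a b Ea Eb /=.
by rewrite !tmapE ff // gg // subrr.
Qed.

Lemma convlDl f f' g c : convl (f \+ f') g c = convl f g c + convl f' g c.
Proof.
rewrite /convl -linearD; congr (mulm _).
apply: (@linear_tensor_ext _ _ _ _ _ (tmap f g \+ tmap f' g)) => a b /=.
by rewrite !tmapE /= tensDl.
Qed.

Lemma convlDr f g g' c : convl f (g \+ g') c = convl f g c + convl f g' c.
Proof.
rewrite /convl -linearD; congr (mulm _).
apply: (@linear_tensor_ext _ _ _ _ _ (tmap f g \+ tmap f g')) => a b /=.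
by rewrite !tmapE /= tensDr.
Qed.

Lemma convlBl f f' g c : convl (f \- f') g c = convl f g c - convl f' g c.
Proof.
rewrite /convl -linearB; congr (mulm _).
apply: (@linear_tensor_ext _ _ _ _ _ (tmap f g \- tmap f' g)) => a b /=.
by rewrite !tmapE /= tensDl tensNl.
Qed.

Lemma convlBr f g g' c : convl f (g \- g') c = convl f g c - convl f g' c.
Proof.
rewrite /convl -linearB; congr (mulm _).
apply: (@linear_tensor_ext _ _ _ _ _ (tmap f g \- tmap f g')) => a b /=.
by rewrite !tmapE /= tensDr tensNr.
Qed.

Lemma eq_convl f f' g g' : f =1 f' -> g =1 g' -> convl f g =1 convl f' g'.
Proof. by move=> ff gg c; rewrite /convl; congr (mulm _); apply: eq_tmap. Qed.

(* Takeuchi's argument: n = ε - γ * γ' vanishes on E, so that n * n vanishes on F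
   and γ' * (ε + n) is a right inverse of γ there; likewise on the left. *)
Lemma conv_inverse_extension E F (p p' : {linear C -> A}) :
  hit_closed E -> hit_closed F -> E `<=` F ->
  (forall c, F c -> exists z,
    tensor_sub E setT (comul c - z) /\ tensor_sub setT E z) ->
  (forall c, E c -> convl p p' c = u c) -> (forall c, E c -> convl p' p c = u c) ->
  exists r : {linear C -> A}, [/\ forall c, E c -> r c = p' c,
    forall c, F c -> convl p r c = u c & forall c, F c -> convl r p c = u c].
Proof.
move=> cE cF EF FE pp' p'p.
have sq0 (n : {linear C -> A}) : (forall c, E c -> n c = 0) ->
    forall c, F c -> convl n n c = 0.
  move=> n0 c /FE[z [cz Ez]]; rewrite /convl -(subrK z (comul c)) linearD linearD /=.
  rewrite (_ : mulm (tmap n n z) = 0) ?addr0.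
    apply: (tensor_sub_ker (f := mulm \o tmap n n)) cz => a b Ea _ /=.
    by rewrite tmapE mulmE n0 // mul0r.
  apply: (tensor_sub_ker (f := mulm \o tmap n n)) Ez => a b _ Eb /=.
  by rewrite tmapE mulmE (n0 b) // mulr0.
pose n : {linear C -> A} := u \- convl p p'.
pose n' : {linear C -> A} := u \- convl p' p.
have n0 c : E c -> n c = 0 by move=> Ec; rewrite /= pp' // subrr.
have n'0 c : E c -> n' c = 0 by move=> Ec; rewrite /= p'p // subrr.
have pr c : F c -> convl p (convl p' (u \+ n)) c = u c.
  move=> Fc; rewrite -convlA convlDr convl1r.
  rewrite (eq_convl (f := convl p p') (f' := u \- n) (g := n) (g' := n)) //; last first.
    by move=> d /=; rewrite opprB addrC subrK.
  by rewrite convlBl sq0 // subr0 convl1l /= addrC subrK.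
have lp c : F c -> convl (convl (u \+ n') p') p c = u c.
  move=> Fc; rewrite convlA convlDl convl1l.
  rewrite (eq_convl (f := n') (f' := n') (g := convl p' p) (g' := u \- n')) //; last first.
    by move=> d /=; rewrite opprB addrC subrK.
  by rewrite convlBr sq0 // subr0 convl1r /= addrC subrK.
exists (convl p' (u \+ n)); split=> // c cc.
  rewrite /= (eq_convl_in (f' := p') (g' := u) cE) ?convl1r // => d Ed.
  by move: (n0 d Ed) => /= ->; rewrite addr0.
(* On F the left inverse l and the right inverse r agree: r = (l * p) * r = l * (p * r) = l. *)
rewrite -[RHS]lp //; apply: (eq_convl_in cF) cc => // d Fd.
rewrite -[LHS]convl1l (eq_convl_in (f' := convl (convl (u \+ n') p') p)
  (g' := convl p' (u \+ n)) cF) //; last by move=> a Fa; symmetry; apply: lp.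
by rewrite convlA (eq_convl_in (f' := convl (u \+ n') p') (g' := u) cF) ?convl1r.
Qed.

End Convolution.

Section TensorAssociativity.
Variables (k : fieldType) (U V W : lmodType k).

Fact tassocV_bilin1 (u : U) : bilin (fun (v : V) (w : W) => (u ⊗ v) ⊗ w).
Proof.
split=> [w|v] a x y; last by rewrite tensPr.
by rewrite tensPr tensPl.
Qed.

Fact tassocV_bilin2 :
  bilin (fun (u : U) (x : V ⊗ W) => tlift (fun v w => (u ⊗ v) ⊗ w) x).
Proof.
split=> [x|u]; last exact: (tlift_linear (tassocV_bilin1 u)).
apply: (tlift_linear_param tassocV_bilin1) => v w a u u'.
by rewrite !tensPl.
Qed.

Definition tassocV : {linear (U ⊗ (V ⊗ W))%type -> ((U ⊗ V) ⊗ W)%type} :=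
  tlin tassocV_bilin2.

Lemma tassocVE u v w : tassocV (u ⊗ (v ⊗ w)) = (u ⊗ v) ⊗ w.
Proof. by rewrite /tassocV tlinE (tliftE (tassocV_bilin1 u)). Qed.

End TensorAssociativity.

Arguments tassocV {k U V W}.

Section TensorLeft.
Variables (k : fieldType) (U V : lmodType k) (u : U).

Definition tensl (v : V) : U ⊗ V := u ⊗ v.

Fact tensl_linear : linear tensl.
Proof. by move=> a x y; rewrite /tensl tensPr. Qed.

HB.instance Definition _ :=
  GRing.isLinear.Build k V (U ⊗ V)%type *:%R tensl tensl_linear.

End TensorLeft.

(** The counit axiom in the form needed once the antipode has collapsed the left factors to a
    multiple of u. *)
Lemma tmap_counitl (k : fieldType) (D : coalgType k) (U V : lmodType k) (u : U)
    (f : {linear D -> U}) (p : {linear D -> V}) (d : D) :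
  (forall x, f x = counit x *: u) -> tmap f p (comul d) = u ⊗ p d.
Proof.
move=> fE; pose e : {linear D -> k^o} := counit.
rewrite -[d in RHS]hitl_counit -/e.
have K : tmap f p =1 tensl u \o p \o slicel e.
  apply: (@linear_tensor_ext _ _ _ _ (tmap f p) (tensl u \o p \o slicel e)) => a b /=.
  by rewrite tmapE slicelE fE linearZ /tensl tensZr tensZl.
exact: K.
Qed.

(** * Orbits of group-like elements and wedges *)

Section ModuleCoalgebra.
Variables (k : fieldType) (H : hopfAlgType k) (C : moduleCoalgType H).
Implicit Types (E F Y : set C) (g c d : C) (a b h : H).

Definition actm : {linear (C ⊗ H)%type -> C} := tlin (ract_bilin C).

Lemma actmE c h : actm (c ⊗ h) = c ◁ h. Proof. exact: tlinE. Qed.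

Definition ractl c h : C := c ◁ h.

Fact ractl_linear c : linear (ractl c).
Proof. by move=> x a b; rewrite /ractl (ract_bilin C).2. Qed.

HB.instance Definition _ c := GRing.isLinear.Build k H C *:%R (ractl c) (ractl_linear c).

Fact mull_linear b : linear (fun a : H => a * b).
Proof. by move=> x a a'; rewrite mulrDl scalerAl. Qed.

Definition mull b a : H := a * b.

HB.instance Definition _ b := GRing.isLinear.Build k H H *:%R (mull b) (mull_linear b).

Definition ract_stable E : Prop := forall c h, E c -> E (c ◁ h).

Definition gorbit g : set C := [set x | exists h, x = g ◁ h].

Lemma comul_grouplike g h : grouplike C g ->
  comul (g ◁ h) = tmap (ractl g) (ractl g) (comul h).
Proof.
move=> [gg _]; rewrite comul_ract gg.
have rb := ract_bilin C; have [_ b0r _ bDr] := bilinE (tbimap_bilin rb rb).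
elim/tensor_ind: (comul h) => [|a b|x y IH IH'].
- by rewrite b0r linear0.
- by rewrite tmapE tbimapE.
- by rewrite bDr IH IH' linearD.
Qed.

Lemma counit_grouplike g h : grouplike C g -> counit (g ◁ h) = counit h.
Proof. by move=> [_ g1]; rewrite counit_ract g1 mul1r. Qed.

Lemma orbit_hit_closed g : grouplike C g -> hit_closed (gorbit g).
Proof.
move=> gg; split.
- split=> [|x _ _ [a ->] [b ->]]; first by exists 0; rewrite -/(ractl g 0) linear0.
  by exists (x *: a + b); apply/esym/ractl_linear.
- move=> f _ [h ->]; rewrite /hitl comul_grouplike // slicel_tmap.
  by exists (slicel (f \o ractl g) (comul h)).
- move=> f _ [h ->]; rewrite /hitr comul_grouplike // slicer_tmap.
  by exists (slicer (f \o ractl g) (comul h)).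
Qed.

Lemma orbit_ract_stable g : ract_stable (gorbit g).
Proof. by move=> _ h [a ->]; exists (a * h); rewrite ractA. Qed.

(** [can] sends g ⊗ h to g ⊗ g h, and ε(g) = 1 recovers h from g ⊗ h. All uses of the injectivity of
    [can] go through this fact. *)
Lemma grouplike_free g h :
  injective (can C) -> grouplike C g -> g ◁ h = 0 -> h = 0.
Proof.
move=> can_inj [gg g1] gh0.
have : can C (g ⊗ h) = can C 0.
  by apply: val_inj; rewrite /= can_funE gg tmapE /= /ractr gh0 tens0r linear0.
move=> /can_inj gh; have := slicelE (counit : {linear C -> k^o}) g h.
by rewrite gh linear0 g1 scale1r => <-.
Qed.

Lemma orbit_coordinate g : injective (can C) -> grouplike C g ->
  exists theta : {linear C -> H}, forall h, theta (g ◁ h) = h.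
Proof.
move=> can_inj gg.
have [theta thetaE] := linear_retraction (i := ractl g)
  (fun h => grouplike_free can_inj gg (h := h)).
by exists theta.
Qed.

Lemma mulm_antipoder h : mulm H (tmap idfun antipode (comul h)) = counit h *: 1.
Proof. by rewrite -[RHS]antipoder (conv_convl idfun antipode). Qed.

Lemma mulm_antipodel h : mulm H (tmap antipode idfun (comul h)) = counit h *: 1.
Proof. by rewrite -[RHS]antipodel (conv_convl antipode idfun). Qed.

(* A right ideal subcoalgebra of H containing h with ε(h) = 1 contains
   h_1 S(h_2) = 1. *)
Lemma grouplike_in_stable E g : injective (can C) -> grouplike C g ->
  hit_closed E -> ract_stable E -> forall h, E (g ◁ h) -> g ◁ h != 0 -> E g.
Proof.
move=> can_inj gg cE rE h Egh gh0; have [sE El _] := cE.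
have [f fgh] : exists f : {linear C -> k^o}, f (g ◁ h) = 1.
  have [|f [_ f1]] := functional_separation (subspace_set0 C) (v := g ◁ h).
    by apply/eqP.
  by exists f.
have [theta thetaE] := orbit_coordinate can_inj gg.
(* A replacement for h of counit 1 that stays in E: g h' = (g h) ↼ f, and ε(h') = f(g h) = 1. *)
pose h' := hitl (f \o ractl g) h.
have h'E : g ◁ h' = hitl f (g ◁ h).
  by rewrite /h' /hitl comul_grouplike // slicel_tmap.
have h'1 : counit h' = 1 by rewrite counit_hitl.
have : E (actm (tmap idfun (antipode \o theta) (comul (g ◁ h')))).
  have /subcoalgebraP[_ EE] := cE.
  suff K : tensor2 E `<=` (actm \o tmap idfun (antipode \o theta)) @^-1` E.
    by apply: K; apply: EE; rewrite h'E; apply: El.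
  apply: lspan_sub => [|_ [c [d [Ec _ ->]]] /=]; first exact: preim_subspace.
  by rewrite tmapE actmE; apply: rE.
rewrite comul_grouplike // tmap_comp.
have -> z : actm (tmap (idfun \o ractl g) ((antipode \o theta) \o ractl g) z) =
    g ◁ mulm H (tmap idfun antipode z).
  apply: (@linear_tensor_ext _ _ _ _ (actm \o _) (ractl g \o mulm H \o tmap idfun antipode)).
  by move=> a b /=; rewrite !tmapE /= actmE mulmE /ractl thetaE ractA.
by rewrite mulm_antipoder h'1 scale1r ract1.
Qed.

(** The wedge E ∧ Y by means of functionals on C / E: [slicel_wedge] turns it into Δ(c) ∈ E ⊗ C + C
    ⊗ Y, while stability under both hits is immediate in this form. *)
Definition wedge E Y : set C :=
  [set c | forall f : {linear C -> k^o}, (forall e, E e -> f e = 0) -> Y (hitl f c)].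

Lemma sub_wedge E Y : hit_closed E -> is_subspace Y -> E `<=` wedge E Y.
Proof. by move=> cE [Y0 _] e Ee f fE; rewrite (hitl_annihilator cE). Qed.

Lemma wedge_hit_closed E Y : hit_closed E -> hit_closed Y -> hit_closed (wedge E Y).
Proof.
move=> cE cY; have [sE El Er] := cE; have [sY Yl Yr] := cY; split.
- split=> [f _|a u v Eu Ev f fE]; first by rewrite linear0; case: sY.
  by rewrite linearP; apply: sY.2; [apply: Eu|apply: Ev].
- move=> t c Ec f fE; rewrite hitl_hitl; apply: Ec => e Ee /=.
  by apply: fE; apply: El.
- by move=> t c Ec f fE; rewrite hitl_hitr; apply/Yr/Ec.
Qed.

(** * Splitting of the Hopf module (E ∧ gH) / E *)

Section Galois.
Variable g : C.
Hypothesis gg : grouplike C g.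

(* Ψ(w ⊗ b) = w b_1 ⊗ g b_2 *)
Definition galois (x : C ⊗ H) : C ⊗ C :=
  tmap actm (ractl g) (tassocV (tmap idfun comul x)).

Fact galois_linear : linear galois.
Proof. by move=> a x y; rewrite /galois !linearP. Qed.

HB.instance Definition _ :=
  GRing.isLinear.Build k (C ⊗ H)%type (C ⊗ C)%type *:%R galois galois_linear.

Lemma galoisE c h : galois (c ⊗ h) = tmap (ractl c) (ractl g) (comul h).
Proof.
rewrite /galois /= tmapE /=.
apply: (@linear_tensor_ext _ _ _ _ (tmap actm (ractl g) \o tassocV \o tensl c)).
by move=> a b /=; rewrite tassocVE !tmapE /= actmE.
Qed.

(* u ⊗ g h = Ψ(u S(h_1) ⊗ h_2) *)
Lemma galois_onto c h : exists y, galois y = c ⊗ (g ◁ h).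
Proof.
pose s := ractl c \o antipode.
exists (tmap s idfun (comul h)).
have E1 z : tmap actm (ractl g) (tassocV (tmap s idfun (tassoc z))) =
    tmap (ractl c \o mulm H \o tmap antipode idfun) (ractl g) z.
  apply: (@tassoc_ext _ _ _ _ _
    (tmap actm (ractl g) \o tassocV \o tmap s idfun \o @tassoc _ H H H)).
  move=> x y w /=; rewrite tassocE !tmapE /= tassocVE !tmapE /= actmE mulmE.
  by rewrite /s /ractl ractA.
rewrite /galois /= tmap_comp.
transitivity (tmap actm (ractl g) (tassocV (tmap s idfun (tmap idfun comul (comul h))))).
  by rewrite tmap_comp; congr (tmap _ _ (tassocV _)); apply: eq_tmap.
rewrite -comulA E1 tmap_comp; apply: tmap_counitl => x /=.
by rewrite mulm_antipodel linearZ /= /ractl ract1.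
Qed.

Section Retraction.
Variables (E : set C) (q : {linear C -> C}) (theta : {linear C -> H}).
Hypotheses (sE : is_subspace E) (rE : ract_stable E).
Hypotheses (qE : forall c, E c -> q c = 0) (Eq : forall c, E (c - q c)).
Hypothesis thetaE : forall h, theta (g ◁ h) = h.

(** In elements, u ⊗ v ↦ q(u S(θ(v)_1)) θ(v)_2. *)
Definition section_tensor (z : C ⊗ C) : C :=
  actm (tmap (q \o actm \o tmap idfun antipode) idfun
    (tassocV (tmap idfun (comul \o theta) z))).

Fact section_tensor_linear : linear section_tensor.
Proof. by move=> a x y; rewrite /section_tensor !linearP. Qed.

HB.instance Definition _ :=
  GRing.isLinear.Build k (C ⊗ C)%type C *:%R section_tensor section_tensor_linear.

(* q(c_1 S(θ(c_2))) θ(c_3): an H-linear section of wedge E (gorbit g) -> wedge E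
   (gorbit g) / E, as in the fundamental theorem of Hopf modules. *)
Definition section_map (c : C) : C := section_tensor (comul c).

Fact section_map_linear : linear section_map.
Proof. by move=> a c d; rewrite /section_map !linearP. Qed.

HB.instance Definition _ :=
  GRing.isLinear.Build k C C *:%R section_map section_map_linear.

(** The antipode cancels on Ψ(w ⊗ b): q(w b_1 S(b_2)) b_3 = q(w) b. Although [q] is only k-linear,
    the result is H-linear in b. *)
Lemma section_galois y : section_tensor (galois y) = actm (tmap q idfun y).
Proof.
apply: (@linear_tensor_ext _ _ _ _ (section_tensor \o galois) (actm \o tmap q idfun)).
move=> w b; rewrite /= galoisE /section_tensor /=.
have E1 z : actm (tmap (q \o actm \o tmap idfun antipode) idfun
      (tassocV (tmap (ractl w) idfun (tassoc z)))) =
    actm (tmap (q \o ractl w \o mulm H \o tmap idfun antipode) idfun z).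
  apply: (@tassoc_ext _ _ _ _ _
    (actm \o tmap (q \o actm \o tmap idfun antipode) idfun \o tassocV
      \o tmap (ractl w) idfun \o @tassoc _ H H H)
    (actm \o tmap (q \o ractl w \o mulm H \o tmap idfun antipode) idfun)).
  move=> x y' z' /=; rewrite tassocE !tmapE /= tassocVE !tmapE /= !tmapE /= !actmE mulmE.
  by rewrite /ractl ractA.
rewrite tmap_comp.
rewrite (_ : tmap _ _ (comul b) = tmap (ractl w) idfun (tmap idfun comul (comul b))).
  rewrite -comulA E1 tmap_comp (tmap_counitl (u := q w)) ?tmapE // => x /=.
  by rewrite mulm_antipoder !linearZ /= /ractl ract1.
rewrite tmap_comp; apply: eq_tmap => // x /=.
by rewrite /ractl thetaE.
Qed.

Lemma section_tensor_ker z : tensor_sub E setT z -> section_tensor z = 0.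
Proof.
have [r0 _ _ _] := bilinE (ract_bilin C).
apply: tensor_sub_ker => u v Eu _; rewrite /= /section_tensor tmapE /=.
elim/tensor_ind: (comul (theta v)) => [|a b|x y IH IH'].
- by rewrite tens0r !linear0.
- by rewrite tassocVE !tmapE /= tmapE /= !actmE qE ?r0 //; apply: rE.
- by rewrite tensDr !linearD /= IH IH' addr0.
Qed.

Lemma wedge_galois c : wedge E (gorbit g) c ->
  exists y, tensor_sub E setT (comul c - galois y).
Proof.
have [sO _ _] := orbit_hit_closed gg.
move=> /(slicel_wedge sE sO)[z [Ez Oz]].
suff [y yz] : exists y, galois y = z by exists y; rewrite yz.
suff K : tensor_sub setT (gorbit g) `<=` [set z | exists y, galois y = z] by apply: K.
apply: lspan_sub => [|_ [c' [_ [_ [h ->] ->]]]]; last exact: galois_onto.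
split=> [|a u v [y <-] [y' <-]]; first by exists 0; rewrite linear0.
by exists (a *: y + y'); rewrite linearP.
Qed.

(** For y = Σ w ⊗ b, applying id ⊗ ε to Δ(c) ≡ Ψ(y) gives c ≡ Σ w b modulo E, and Σ w b ≡ Σ q(w) b
    because w - q(w) lies in E, which H preserves. *)
Lemma section_mod c y : tensor_sub E setT (comul c - galois y) ->
  section_map c = actm (tmap q idfun y) /\ E (c - section_map c).
Proof.
move=> cy; have sc : section_map c = actm (tmap q idfun y).
  rewrite /section_map -(subrK (galois y) (comul c)) linearD /=.
  by rewrite section_tensor_ker // add0r section_galois.
split=> //; rewrite sc.
pose e : {linear C -> k^o} := counit.
have Ey : E (c - actm y).
  have -> : c - actm y = slicer e (comul c - galois y).
    rewrite (linearB (slicer e)) -[c in LHS]hitr_counit; congr (_ - _).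
    apply: (@linear_tensor_ext _ _ _ _ actm (slicer e \o galois)) => w b /=.
    rewrite galoisE slicer_tmap actmE -[b in LHS]hitr_counit -/(ractl w _).
    congr (ractl w _); apply: eq_slicer => x /=.
    by rewrite /e counit_grouplike.
  exact: slicer_tensor_sub cy.
rewrite -(subrK (actm y) c) -addrA; apply: (subspaceD sE) => //.
elim/tensor_ind: y {cy sc Ey} => [|w b|x y IH IH'].
- by rewrite !linear0 addr0; case: sE.
- rewrite tmapE !actmE /=.
  have -> : w ◁ b - q w ◁ b = (w - q w) ◁ b.
    have [_ _ rD _] := bilinE (ract_bilin C).
    by apply/eqP; rewrite subr_eq -rD subrK.
  exact: rE.
- by rewrite !linearD /= addrACA; apply: subspaceD.
Qed.

(** Ψ carries right multiplication on the factor H to the diagonal action: Ψ(w ⊗ b h) = Ψ(w ⊗ b)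
    h. *)
Lemma section_ract c y h : tensor_sub E setT (comul c - galois y) ->
  tensor_sub E setT (comul (c ◁ h) - galois (tmap idfun (mull h) y)).
Proof.
have rb := ract_bilin C; have mb := mul_bilin H.
have [t0l t0r tDl tDr] := bilinE (tbimap_bilin rb rb).
pose diag : {linear (C ⊗ C)%type -> (C ⊗ C)%type} :=
  HB.pack (fun z : C ⊗ C => tbimap ract ract z (comul h))
    (GRing.isLinear.Build _ _ _ _ _ ((tbimap_bilin rb rb).1 (comul h))).
have diag_galois z : diag (galois z) = galois (tmap idfun (mull h) z).
  apply: (@linear_tensor_ext _ _ _ _ (diag \o galois) (galois \o tmap idfun (mull h))).
  move=> w b; rewrite /= tmapE !galoisE comulM; set M := (X in _ = tmap _ _ (X _ _)).
  have [m0l m0r mDl mDr] := bilinE (tbimap_bilin mb mb : bilin M).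
  have ME x1 x2 y1 y2 : M (x1 ⊗ x2) (y1 ⊗ y2) = (x1 * y1) ⊗ (x2 * y2).
    exact: (tbimapE mb mb).
  elim/tensor_ind: (comul b) => [|b1 b2|x x' IH IH'].
  - by rewrite m0l !linear0 t0l.
  - elim/tensor_ind: (comul h) => [|h1 h2|x x' IH IH'].
    + by rewrite m0r t0r linear0.
    + by rewrite ME !tmapE tbimapE // /= /ractl !ractA.
    + by rewrite mDr tDr IH IH' linearD.
  - by rewrite mDl !linearD /= tDl IH IH'.
move=> cy; rewrite comul_ract -diag_galois -[tbimap _ _ _ _]/(diag (comul c)) -linearB.
suff K : tensor_sub E setT `<=` diag @^-1` tensor_sub E setT by apply: K.
have sX := tensor_sub_subspace E (@setT C).
apply: lspan_sub => [|_ [u [v [Eu _ ->]]] /=]; first exact: preim_subspace.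
elim/tensor_ind: (comul h) => [|h1 h2|x x' IH IH'].
- by rewrite t0r; case: sX.
- by rewrite tbimapE //; apply: tensor_sub_gen => //; apply: rE.
- by rewrite tDr; apply: (subspaceD sX).
Qed.

Lemma section_map_ract c h : wedge E (gorbit g) c ->
  section_map (c ◁ h) = section_map c ◁ h.
Proof.
move=> /wedge_galois[y cy].
have [-> _] := section_mod cy; have [-> _] := section_mod (section_ract h cy).
have [r0 _ rD _] := bilinE (ract_bilin C).
elim/tensor_ind: y {cy} => [|w b|x x' IH IH'].
- by rewrite !linear0 r0.
- by rewrite !tmapE !actmE /= ractA.
- by rewrite !linearD /= IH IH' rD.
Qed.

End Retraction.

(** With s the section, c ↦ c - s(c) is an H-linear projection of the wedge onto E; the extension is
    p composed with it. *)
Lemma wedge_linear_extension E (p : {linear C -> H}) :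
  injective (can C) -> hit_closed E -> ract_stable E ->
  (forall c h, E c -> p (c ◁ h) = p c * h) ->
  ract_stable (wedge E (gorbit g)) /\
  exists r : {linear C -> H}, (forall c, E c -> r c = p c) /\
    forall c h, wedge E (gorbit g) c -> r (c ◁ h) = r c * h.
Proof.
move=> can_inj cE rE pE; have [sE _ _] := cE.
have [q [qE Eq]] := linear_projection sE.
have [theta thetaE] := orbit_coordinate can_inj gg.
have wr : ract_stable (wedge E (gorbit g)).
  move=> c h /(wedge_galois sE)[y /(section_ract rE h)].
  set y' := tmap _ _ _ => cy f fE.
  rewrite /hitl -(subrK (galois y') (comul _)) linearD /=.
  rewrite [slicel _ (_ - _)](tensor_sub_ker _ cy) ?add0r; last first.
    by move=> u v Eu _; rewrite slicelE fE // scale0r.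
  elim/tensor_ind: y' {cy} => [|w b|x x' IH IH'].
  - by rewrite !linear0; apply: subspace0; case: (orbit_hit_closed gg).
  - by rewrite galoisE slicel_tmap; exists (slicel (f \o ractl w) (comul b)).
  - by rewrite !linearD; apply: subspaceD => //; case: (orbit_hit_closed gg).
split=> //; pose s := section_map q theta.
have Es c : wedge E (gorbit g) c -> E (c - s c).
  by move=> /(wedge_galois sE)[y /(section_mod sE rE qE Eq thetaE)[]].
exists (p \o (idfun \- s)); split=> [c Ec|c h wc] /=.
  have /subcoalgebraP[_ /(_ c Ec) EE] := cE.
  rewrite /s /section_map (section_tensor_ker theta rE qE) ?subr0 //.
  exact: (tensor_subS (S := E) (T := E)) EE.
rewrite -pE; last exact: Es.
congr (p _); have [_ _ rD _] := bilinE (ract_bilin C).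
by apply/eqP; rewrite subr_eq (section_map_ract sE rE) // -rD subrK.
Qed.

End Galois.

End ModuleCoalgebra.

(** * Maximal partial cleavings *)

Section PartialCleaving.
Variables (k : fieldType) (H : hopfAlgType k) (C : moduleCoalgType H).
Implicit Types (E : set C) (g c : C) (h : H).

(** Both maps are defined on all of C, but only their values on the subcoalgebra [domain] count, and
    these determine the convolution products there. Hence [extends] is merely a preorder. *)
Record partial_cleaving : Type := PartialCleaving {
  domain : set C;
  cleaving : {linear C -> H};
  cocleaving : {linear C -> H};
  domain_closed : hit_closed domain;
  domain_stable : ract_stable domain;
  cleaving_ract : forall c h, domain c -> cleaving (c ◁ h) = cleaving c * h;
  cleavingr : forall c, domain c -> convl cleaving cocleaving c = conv1 H c;
  cleavingl : forall c, domain c -> convl cocleaving cleaving c = conv1 H c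
}.

Definition extends (s t : partial_cleaving) : Prop :=
  [/\ domain s `<=` domain t,
    forall c, domain s c -> cleaving t c = cleaving s c
    & forall c, domain s c -> cocleaving t c = cocleaving s c].

Lemma extends_refl s : extends s s. Proof. by split. Qed.

Lemma extends_trans r s t : extends r s -> extends s t -> extends r t.
Proof.
move=> [rs rs1 rs2] [st st1 st2]; split=> [|c rc|c rc].
- exact: subset_trans st.
- by rewrite st1 ?rs1 //; apply: rs.
- by rewrite st2 ?rs2 //; apply: rs.
Qed.

Lemma trivial_cleaving : partial_cleaving.
Proof.
apply: (@PartialCleaving [set 0] \0 \0) => [|_ h ->|c h _|_ ->|_ ->].
- exact: hit_closed0.
- by have [r0 _ _ _] := bilinE (ract_bilin C); rewrite /= r0.
- by rewrite mul0r.
- by rewrite !linear0.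
- by rewrite !linear0.
Qed.

(** Here [sel] stands for [cleaving] or [cocleaving]. Along a chain the union of the graphs over the
    domains is again a graph, extended linearly to C. *)
Lemma chain_glue (A : set partial_cleaving) (s0 : partial_cleaving)
    (sel : partial_cleaving -> {linear C -> H}) : A s0 -> total_on A extends ->
  (forall s t, extends s t -> forall c, domain s c -> sel t c = sel s c) ->
  exists f : {linear C -> H}, forall s c, A s -> domain s c -> f c = sel s c.
Proof.
move=> As0 Atot selP.
have [|w [s [_ _ /= ->]]|f fP] := @linear_extension k C H
    [set x | exists s, [/\ A s, domain s x.1 & x.2 = sel s x.1]].
- split=> [|a [c x] [d y] [s [As /= sc ->]] [t [At /= td ->]]].
    by exists s0; split; rewrite //= ?linear0 //; case: (domain_closed s0) => -[].
  have [r [Ar rc rd -> ->]] : exists r, [/\ A r, domain r c, domain r d,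
      sel s c = sel r c & sel t d = sel r d].
    have [st|ts] := Atot s t As At.
    + by exists t; split=> //; [case: st => st _ _; apply: st|rewrite (selP s t)].
    + by exists s; split=> //; [case: ts => ts _ _; apply: ts|rewrite (selP t s)].
  exists r; split=> //=; last by rewrite linearP.
  by case: (domain_closed r) => -[_ rL] _ _; apply: rL.
- exact: linear0.
by exists f => s c As sc; apply: fP; exists s.
Qed.

Lemma chain_bound (A : set partial_cleaving) : total_on A extends ->
  exists t, forall s, A s -> extends s t.
Proof.
move=> Atot; have [[s0 As0]|A0] := pselect (exists s, A s); last first.
  by exists trivial_cleaving => s As; case: A0; exists s.
have [p pP] := chain_glue As0 Atot (sel := cleaving)
  (fun s t st => let: And3 _ st1 _ := st in st1).
have [p' pP'] := chain_glue As0 Atot (sel := cocleaving)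
  (fun s t st => let: And3 _ _ st2 := st in st2).
pose U : set C := [set c | exists2 s, A s & domain s c].
have cU : hit_closed U.
  split; [split=> [|a c d [s As sc] [t At td]]|move=> f c [s As sc]..].
  - by exists s0 => //; case: (domain_closed s0) => -[].
  - have [[st _ _]|[ts _ _]] := Atot s t As At.
    + exists t => //; case: (domain_closed t) => -[_ tL] _ _; apply: tL => //.
      exact: st.
    + exists s => //; case: (domain_closed s) => -[_ sL] _ _; apply: sL => //.
      exact: ts.
  - by exists s => //; case: (domain_closed s) => _ sl _; apply: sl.
  - by exists s => //; case: (domain_closed s) => _ _ sr; apply: sr.
have rU : ract_stable U by move=> c h [s As /(domain_stable h)]; exists s.
have Up c h : U c -> p (c ◁ h) = p c * h.
  move=> [s As sc]; rewrite (pP s) //; last exact: domain_stable.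
  by rewrite (pP s) // cleaving_ract.
have Ur c : U c -> convl p p' c = conv1 H c.
  move=> [s As sc]; rewrite -(cleavingr sc).
  by apply: (eq_convl_in (domain_closed s)) sc => d sd; rewrite (pP s, pP' s).
have Ul c : U c -> convl p' p c = conv1 H c.
  move=> [s As sc]; rewrite -(cleavingl sc).
  by apply: (eq_convl_in (domain_closed s)) sc => d sd; rewrite (pP s, pP' s).
exists (PartialCleaving cU rU Up Ur Ul) => s As; split=> c sc /=.
- by exists s.
- exact: pP.
- exact: pP'.
Qed.

Lemma maximal_cleaving : exists m, forall t, extends m t -> extends t m.
Proof.
have [|||m mmax] := @ZL_preorder _ trivial_cleaving (fun s t => `[< extends s t >]).
- by move=> t; apply/asboolP; apply: extends_refl.
- by move=> r s t /asboolP rs /asboolP st; apply/asboolP; apply: extends_trans st.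
- move=> A Atot; have [|t tP] := @chain_bound A.
    by move=> s t As At; case: (Atot s t As At) => /asboolP; [left|right].
  by exists t => s As; apply/asboolP/tP.
by exists m => t mt; apply/asboolP/mmax/asboolP.
Qed.

Hypothesis can_inj : injective (can C).

Lemma maximal_grouplike m g : (forall t, extends m t -> extends t m) ->
  grouplike C g -> domain m g.
Proof.
move=> mmax gg; apply: contrapT => mg.
have cm := domain_closed m; have cO := orbit_hit_closed gg.
have [sm _ _] := cm; have [sO _ _] := cO.
have rm := @domain_stable m.
have mO c : domain m c -> gorbit g c -> c = 0.
  move=> mc [h cE]; apply: contrapT => /eqP c0; apply: mg.
  by apply: (grouplike_in_stable can_inj gg cm rm (h := h)); rewrite -cE.
have [theta thetaE] := orbit_coordinate can_inj gg.
have [p [pm pO]] := linear_glue (cleaving m) theta sm sO mO.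
have [p' [pm' pO']] := linear_glue (cocleaving m) (antipode \o theta) sm sO mO.
have cF : hit_closed (setadd (domain m) (gorbit g)) by apply: hit_closedD.
have [_ _ rD _] := bilinE (ract_bilin C).
have rF : ract_stable (setadd (domain m) (gorbit g)).
  move=> _ h [c [d [mc Od ->]]]; rewrite rD; exists (c ◁ h), (d ◁ h).
  by split=> //; [apply: rm|apply: orbit_ract_stable].
have pF c h : setadd (domain m) (gorbit g) c -> p (c ◁ h) = p c * h.
  move=> [d [e [md Oe ->]]]; have [a eE] := Oe.
  rewrite rD !linearD /= mulrDl (pm _ md) (pm _ (rm d h md)) cleaving_ract //.
  congr (_ + _).
  by rewrite !pO //; [rewrite eE ractA !thetaE|apply: orbit_ract_stable].
(* On the subcoalgebra g H, carried over to H by [theta], the two products are the antipode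
   axioms. *)
have antip h : convl p p' (g ◁ h) = conv1 H (g ◁ h) /\
    convl p' p (g ◁ h) = conv1 H (g ◁ h).
  have Ogh : gorbit g (g ◁ h) by exists h.
  rewrite /conv1 counit_grouplike // -mulm_antipoder; split.
    rewrite (eq_convl_in cO pO pO') // /convl comul_grouplike // tmap_comp.
    by congr (mulm _ _); apply: eq_tmap => x /=; rewrite /ractl thetaE.
  rewrite mulm_antipoder -mulm_antipodel.
  rewrite (eq_convl_in cO pO' pO) // /convl comul_grouplike // tmap_comp.
  by congr (mulm _ _); apply: eq_tmap => x /=; rewrite /ractl thetaE.
have Fr c : setadd (domain m) (gorbit g) c -> convl p p' c = conv1 H c.
  move=> [d [_ [md [h ->] ->]]]; rewrite [LHS]linearD [RHS]linearD /=.
  rewrite (antip h).1; congr (_ + _).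
  by rewrite (eq_convl_in cm pm pm') // cleavingr.
have Fl c : setadd (domain m) (gorbit g) c -> convl p' p c = conv1 H c.
  move=> [d [_ [md [h ->] ->]]]; rewrite [LHS]linearD [RHS]linearD /=.
  rewrite (antip h).2; congr (_ + _).
  by rewrite (eq_convl_in cm pm' pm) // cleavingl.
have [|Fm _ _] := mmax (PartialCleaving cF rF pF Fr Fl).
  by split=> // c mc; apply: setaddl.
by apply/mg/Fm; apply: setaddr => //; exists 1; rewrite ract1.
Qed.

(** An element of G(C)H lies in a finite sum of orbits, each a subcoalgebra, and [disjoint_setadd]
    adjoins them one at a time. *)
Lemma GCH_disjoint (A : set C) : hit_closed A ->
  (forall g, grouplike C g -> A `&` gorbit g `<=` [set 0]) ->
  A `&` GCH C `<=` [set 0].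
Proof.
move=> cA AO a [Aa Ga].
suff [Y [cY AY Ya]] : exists Y, [/\ hit_closed Y, A `&` Y `<=` [set 0] & Y a].
  exact: AY.
suff K : GCH C `<=` [set c | exists Y, [/\ hit_closed Y, A `&` Y `<=` [set 0] & Y c]].
  exact: K.
apply: lspan_sub => [|c [g gg [h ->]]]; last first.
  by exists (gorbit g); split; [apply: orbit_hit_closed|apply: AO|exists h].
split=> [|x u v [Y [cY AY Yu]] [Z [cZ AZ Zv]]].
  by exists [set 0]; split=> //; exact: hit_closed0.
exists (setadd Y Z); split; [exact: hit_closedD|exact: disjoint_setadd|].
by exists (x *: u), v; split=> //; apply: subspaceZ => //; case: cY.
Qed.

Hypothesis coradical_sub : coradical C `<=` GCH C.

Lemma maximal_total m c : (forall t, extends m t -> extends t m) -> domain m c.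
Proof.
move=> mmax; apply: contrapT => mc.
have cm := domain_closed m; have [sm _ _] := cm.
have [|A [x [simA mx Ax]]] := simple_coefficients cm; first by exists c.
have [sA [a Aa a0] Amin] := simA; have /subcoalgebraP cA := sA.
(* By simplicity A ∩ g H is 0 or A for each g. Were it always 0, A would meet G(C)H trivially,
   although A lies in the coradical and so in G(C)H. *)
have [g [gg AO]] : exists g, grouplike C g /\ A `<=` gorbit g.
  apply: contrapT => Ng; move/eqP: a0; apply.
  apply: (GCH_disjoint cA); last first.
    by split=> //; apply: coradical_sub; apply: sub_lspan; exists A.
  move=> g gg; have cO := orbit_hit_closed gg.
  have [|b [Ab _]|->|AOA] := Amin (A `&` gorbit g).
  - by apply/subcoalgebraP/hit_closedI.
  - by [].
  - by [].
  - by case: Ng; exists g; split=> // b; rewrite -{1}AOA => -[].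
have cO := orbit_hit_closed gg; have [sO _ _] := cO.
have [rF [p [pm pF]]] := wedge_linear_extension gg can_inj cm (@domain_stable m)
  (@cleaving_ract m).
have cF := wedge_hit_closed cm cO; have mF := sub_wedge cm sO.
have Om : gorbit g `<=` domain m.
  by move=> _ [h ->]; apply/domain_stable/maximal_grouplike.
have [d /(slicel_wedge sm sO)[z [dz Oz]]|e me|e me|p' [pm' Fr Fl]] :=
  @conv_inverse_extension _ _ _ _ _ p (cocleaving m) cm cF mF.
- by exists z; split=> //; apply: tensor_subS Oz.
- by rewrite (eq_convl_in cm pm (g' := cocleaving m)) // cleavingr.
- by rewrite (eq_convl_in cm (f' := cocleaving m) _ pm) // cleavingl.
have [//|Fm _ _] := mmax (PartialCleaving cF rF pF Fr Fl).
(* The coefficients x ↼ f lie in A, inside g H, so x is in the wedge but not in the domain of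
   [m]. *)
by apply/mx/Fm => f fm; apply/AO/Ax.
Qed.

End PartialCleaving.

Theorem corollary5p5 (k : fieldType) (H : hopfAlgType k) (C : moduleCoalgType H)
    (can_inj : injective (can C))
    (coradical_sub : coradical C `<=` GCH C) :
  cocleft C.
Proof.
have [m mmax] := maximal_cleaving C.
have mC c : domain m c := maximal_total can_inj coradical_sub c mmax.
exists (cleaving m), (cocleaving m); split=> [c h|c|c].
- exact: cleaving_ract.
- by rewrite conv_convl cleavingr.
- by rewrite conv_convl cleavingl.
Qed.
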